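(* Let $d\ge 2$, let $E\subseteq\mathbb{R}^d$ be compact, and let $k\ge 3$ be an integer. Define the $k$-point configuration set $$\mathring{\Delta}_k^{diag}(E)=\left\{\,\left|(x,\dots,x)-(y_1,\dots,y_{k-1})\right| \;:\; x,y_1,\dots,y_{k-1}\in E,\ y_i\neq y_j \text{ for all } i\neq j\,\right\}\subseteq\mathbb{R}.$$ If $$\dim(E)>\begin{cases}\dfrac{2d+1}{3}, & k=3,\\[2mm] \dfrac{(k-1)d}{k}, & k\ge 4,\end{cases}$$ then $\operatorname{Int}\big(\mathring{\Delta}_k^{diag}(E)\big)\neq\varnothing$.
   Context: $\dim(E)$ denotes the Hausdorff dimension of $E$. Here $(x,\dots,x)$ (with $x$ repeated $k-1$ times) and $(y_1,\dots,y_{k-1})$ are points of $(\mathbb{R}^d)^{k-1}=\mathbb{R}^{(k-1)d}$, and $|\cdot|$ is the Euclidean norm on $\mathbb{R}^{(k-1)d}$. $\operatorname{Int}$ denotes the interior in $\mathbb{R}$. *)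

(* Defs.v *)
From HB Require Import structures.
From mathcomp Require Import all_boot all_order all_algebra.
From mathcomp Require Import all_classical all_reals all_analysis.
Import Order.TTheory GRing.Theory Num.Theory.
Import numFieldNormedType.Exports.

Set Implicit Arguments.
Unset Strict Implicit.
Unset Printing Implicit Defensive.

Local Open Scope classical_set_scope.
Local Open Scope ring_scope.

(* The canonical norm `|v| on row vectors is the sup norm, hence this separate
   Euclidean norm.  Both induce the same topology, so the library's compactness
   on 'rV[R]_n is the usual one. *)
Definition enorm (R : realType) (n : nat) (v : 'rV[R]_n) : R :=
  Num.sqrt (\sum_(i < n) v ord0 i ^+ 2).

(* The maximum with 0 sets ediam set0 = 0, as ereal_sup set0 = -oo. *)
Definition ediam (R : realType) (n : nat) (A : set 'rV[R]_n) : \bar R :=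
  maxe 0%E (ereal_sup [set (enorm (x - y))%:E | x in A & y in A]).

(* diam(A)^s; since 0 `^ 0 = 1, the empty set is treated separately in order
   not to contribute when s = 0. *)
Definition hausdorff_gauge (R : realType) (n : nat) (s : R)
    (A : set 'rV[R]_n) : \bar R :=
  if `[< A = set0 >] then 0%E else (ediam A `^ s)%E.

Definition hausdorff_premeasure (R : realType) (n : nat) (s delta : R)
    (A : set 'rV[R]_n) : \bar R :=
  ereal_inf
    [set (\sum_(0 <= i <oo) hausdorff_gauge s (U i))%E
      | U in [set U : (set 'rV[R]_n)^nat |
               A `<=` \bigcup_i U i
               /\ forall i, (ediam (U i) <= delta%:E)%E]].

(* The limit as delta -> 0+ is a supremum, by monotonicity in delta. *)
Definition hausdorff_measure (R : realType) (n : nat) (s : R)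
    (A : set 'rV[R]_n) : \bar R :=
  ereal_sup [set hausdorff_premeasure s delta A | delta in [set r : R | 0 < r]].

Definition hausdorff_dim (R : realType) (n : nat) (A : set 'rV[R]_n) : \bar R :=
  ereal_inf [set s%:E | s in
    [set s : R | 0 <= s /\ hausdorff_measure s A = 0%E]].

(* A point (z_1, ..., z_m) of (R^d)^m is regarded as a vector of R^(m * d). *)
Definition concat_vec (R : realType) (m d : nat) (z : 'I_m -> 'rV[R]_d) :
    'rV[R]_(m * d) :=
  mxvec (\matrix_(i < m) z i).

Definition diag_config_set (R : realType) (d k : nat) (E : set 'rV[R]_d) :
    set R :=
  [set t : R | exists (x : 'rV[R]_d) (y : 'I_k.-1 -> 'rV[R]_d),
     [/\ E x,
         forall i, E (y i),
         forall i j, i != j -> y i != y j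
       & t = enorm (concat_vec (fun _ : 'I_k.-1 => x) - concat_vec y)]].

Definition dim_threshold (R : realType) (d k : nat) : R :=
  if k == 3%N then (2 * d%:R + 1) / 3 else ((k%:R - 1) * d%:R) / k%:R.

(* Main.v *)
Require Import Defs.
From HB Require Import structures.
From mathcomp Require Import all_boot all_order all_algebra.
From mathcomp Require Import all_classical all_reals all_analysis.
From mathcomp Require Import finmap complex ring lra zify.
Import Order.TTheory GRing.Theory Num.Theory.
Import numFieldNormedType.Exports.
Import Normc.
Set Implicit Arguments.
Unset Strict Implicit.
Unset Printing Implicit Defensive.
Local Open Scope classical_set_scope.
Local Open Scope ring_scope.

(** The theorem is true because both thresholds are at least (d + 1) / 2, and
    dim E > (d + 1) / 2 already forces an interval of values.

    Fix s with (d + 1) / 2 < s < dim E. Then E carries mass that is spread out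
    in the sense of Frostman: cubes of side r have mass at most r^s. There are
    in fact infinitely many points all of whose neighbourhoods in E carry such
    mass [heavy_points]. Choose k - 1 of them, keep all but two of the y_i
    fixed at these points, and let y_1 and y_2 vary in small disjoint pieces E1
    and E2 of E around the remaining two, and x in E1; the y_i are then
    automatically distinct. It remains to find an interval among the values of
    |x - y_1|^2 + |x - y_2|^2 + g(x), where g collects the fixed points.

    The Fourier transform at j of the distribution of these values is the
    integral over x of e(j g(x)) F_1(x) F_2(x), where F_i(x) is the integral of
    e(j |x - y_i|^2) over y_i. The unimodular factor e(j g(x)) is harmless, and
    by Cauchy-Schwarz everything reduces to the mean square of F_i, which is
    O(j^(d - 2s)) by an almost orthogonality argument [bilinear_estimate].
    Since 2s - d > 1, the Fourier transform is summable, so the distribution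
    has a continuous density and the values contain an interval.

    All of this is carried out on dyadic grids with finitely many weighted
    points, where integrals are finite sums, and with estimates that are
    uniform in the mesh 2^-n. The Frostman weights come from a greedy algorithm
    [greedy_weights] whose saturated cubes form a cover, so that their mass is
    bounded below by Hausdorff content [frostman_set]. The density is replaced
    by a count with a Fejer kernel, whose positive definiteness and uniform
    modulus of continuity give an interval, of length independent of n, all of
    whose points are close to attained values [discrete_interval]. As E1 and
    E2 are compact, the limit of these approximate values is attained
    [frostman_config_interval]. *)

(** * Unimodular complex numbers *)

Definition cis (R : realType) (t : R) : R[i] := Complex (cos t) (sin t).

Lemma cisD (R : realType) (s t : R) : cis (s + t) = cis s * cis t.
Proof. by rewrite /cis cosD sinD; simpc; congr Complex; ring. Qed.

Lemma cis0 (R : realType) : cis (0 : R) = 1.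
Proof. by rewrite /cis cos0 sin0. Qed.

Lemma normc_cis (R : realType) (t : R) : normc (cis t) = 1.
Proof. by rewrite /= cos2Dsin2 sqrtr1. Qed.

Lemma conj_cis (R : realType) (t : R) : ((cis t)^*)%C = cis (- t).
Proof. by rewrite /cis cosN sinN. Qed.

Lemma cis_sum (R : realType) (I : Type) (s : seq I) (P : pred I) (f : I -> R) :
  cis (\sum_(i <- s | P i) f i) = \prod_(i <- s | P i) cis (f i).
Proof. by apply: (big_morph (@cis R) (@cisD R) (cis0 R)). Qed.

Lemma normc_ge0 (R : realType) (z : R[i]) : 0 <= normc z.
Proof. by case: z => a b; apply: sqrtr_ge0. Qed.

Lemma normc_real (R : realType) (x : R) : normc (x%:C)%C = `|x|.
Proof. by rewrite /= expr0n /= addr0 sqrtr_sqr. Qed.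

Lemma normc_sum (R : realType) (I : Type) (s : seq I) (P : pred I)
    (f : I -> R[i]) :
  normc (\sum_(i <- s | P i) f i) <= \sum_(i <- s | P i) normc (f i).
Proof.
elim/big_rec2: _ => [|i y1 y2 _ IH]; first by rewrite normc0.
by apply: le_trans (le_normcD _ _) _; rewrite lerD2l.
Qed.

Lemma normc_prod (R : realType) (I : Type) (s : seq I) (P : pred I)
    (f : I -> R[i]) :
  normc (\prod_(i <- s | P i) f i) = \prod_(i <- s | P i) normc (f i).
Proof. by apply: (big_morph (@normc R) (@normcM R) (@normc1 R)). Qed.

Lemma normc_ge_absRe (R : realType) (z : R[i]) : `|complex.Re z| <= normc z.
Proof. by have := normc_ge_Re z; rewrite normc_def lecR; case: z. Qed.

Lemma sqr_normcE (R : realType) (z : R[i]) :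
  ((normc z ^+ 2)%:C)%C = z * (z^*)%C.
Proof.
by rewrite -sqr_normc normc_def rmorphXn; case: z.
Qed.

(** Opening the square. This identity converts mean squares of exponential sums
    into sums over pairs of points, and back. *)
Lemma sqr_normc_sum (R : realType) (I : finType) (f : I -> R[i]) :
  ((normc (\sum_i f i) ^+ 2)%:C)%C = \sum_i \sum_j f i * ((f j)^*)%C.
Proof.
rewrite sqr_normcE rmorph_sum mulr_suml; apply: eq_bigr => i _.
by rewrite mulr_sumr.
Qed.

(** Cauchy-Schwarz against the constant 1, read off from the sum of the squares
    of all differences. *)
Lemma sqr_sum_le (R : realType) (I : finType) (f : I -> R) :
  (\sum_i f i) ^+ 2 <= #|I|%:R * \sum_i f i ^+ 2.
Proof.
have : 0 <= \sum_i \sum_j (f i - f j) ^+ 2.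
  by do 2!(apply: sumr_ge0 => ? _); apply: sqr_ge0.
suff -> : \sum_i \sum_j (f i - f j) ^+ 2 =
    2 * (#|I|%:R * \sum_i f i ^+ 2 - (\sum_i f i) ^+ 2).
  by rewrite pmulr_rge0 ?subr_ge0.
transitivity (\sum_i \sum_j (f i ^+ 2 + f j ^+ 2 - 2 * (f i * f j))).
  by apply: eq_bigr => i _; apply: eq_bigr => j _; ring.
under eq_bigr => i _ do rewrite sumrB big_split /= sumr_const -!mulr_sumr.
rewrite sumrB big_split /= sumr_const -mulr_sumr -mulr_suml sumrMnl.
by rewrite -[#|xpredT|]/#|I| -mulr_natl; ring.
Qed.

Lemma sqr_normc_sum_le (R : realType) (I : finType) (f : I -> R[i]) :
  normc (\sum_i f i) ^+ 2 <= #|I|%:R * \sum_i normc (f i) ^+ 2.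
Proof.
apply: le_trans (sqr_sum_le (fun i => normc (f i))).
by rewrite ler_sqr ?nnegrE ?normc_ge0 ?sumr_ge0// ?normc_sum// => i _;
  apply: normc_ge0.
Qed.

Lemma sin_le_id (R : realType) (x : R) : 0 <= x -> sin x <= x.
Proof.
move=> x0.
have df (t : R) : is_derive t 1 (fun t => t - sin t) (1 - cos t).
  by apply: is_deriveB.
rewrite -subr_ge0 -[leLHS](_ : (fun t => t - sin t) 0 = 0);
  last by rewrite sin0 subrr.
move: x0; rewrite le_eqVlt => /orP[/eqP<-//|x0].
have [c _] := @MVT R (fun t => t - sin t) (fun t => 1 - cos t) 0 x x0
  (fun t _ => df t) ltac:(by apply: continuous_subspaceT => t;
     apply/differentiable_continuous/derivable1_diffP;
       apply: (@ex_derive _ _ _ _ _ _ _ (df t))).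
move=> E; rewrite -subr_ge0 E subr0; apply: mulr_ge0; last exact: ltW.
by rewrite subr_ge0 cos_le1.
Qed.

Lemma sqr_sin_le (R : realType) (x : R) : sin x ^+ 2 <= x ^+ 2.
Proof.
wlog x0 : x / 0 <= x.
  move=> H; have [/H//|/ltW x0] := leP 0 x.
  by rewrite -sqrrN -sinN -[leRHS]sqrrN; apply: H; rewrite oppr_ge0.
rewrite -[leLHS]real_normK ?num_real// ler_sqr ?nnegrE//.
rewrite ler_norml sin_le_id// andbT.
have [x1|x1] := leP x 1; last by apply: le_trans (sin_geN1 _);
  rewrite lerN2 ltW.
apply: (@le_trans _ _ 0); first by rewrite oppr_le0.
apply: sin_ge0_pi; rewrite x0/= (le_trans x1)//.
by have := pi_ge2 R; lra.
Qed.

Lemma cos_ge (R : realType) (x : R) : 1 - x ^+ 2 / 2 <= cos x.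
Proof.
have -> : cos x = 1 - 2 * sin (x / 2) ^+ 2.
  rewrite [in LHS](_ : x = x / 2 + x / 2); last by lra.
  by rewrite cosD; have := cos2Dsin2 (x / 2); lra.
by have := sqr_sin_le (x / 2); rewrite expr_div_n; lra.
Qed.

(** On [0, 1] the derivative cos - 1/2 of sin x - x / 2 is nonnegative, because
    cos x is at least 1 - x^2 / 2. *)
Lemma sin_ge_half (R : realType) (x : R) : 0 <= x <= 1 -> x / 2 <= sin x.
Proof.
move=> /andP[x0 x1].
have df (t : R) : is_derive t 1 (fun t => sin t - 2^-1 * t) (cos t - 2^-1).
  by apply: is_deriveB; apply: is_derive_eq; rewrite /GRing.scale /= mulr1.
rewrite -subr_ge0.
move: x0; rewrite le_eqVlt => /orP[/eqP<-|x0]; first by rewrite sin0; lra.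
have [c] := @MVT R (fun t => sin t - 2^-1 * t) (fun t => cos t - 2^-1) 0 x x0
  (fun t _ => df t) ltac:(by apply: continuous_subspaceT => t;
     apply/differentiable_continuous/derivable1_diffP;
       apply: (@ex_derive _ _ _ _ _ _ _ (df t))).
rewrite in_itv /= => /andP[c0 cx].
rewrite sin0 mulr0 !subr0 [_ / 2]mulrC => ->.
apply: mulr_ge0; last exact: ltW.
rewrite subr_ge0 (le_trans _ (cos_ge c))//.
have : c ^+ 2 <= 1 by rewrite expr_le1 ?ltW// (lt_le_trans cx).
by lra.
Qed.

(** The chord |e^{iu} - 1| is 2 |sin (u / 2)|. *)
Lemma normc_cisB1_ge (R : realType) (u : R) : `|u| <= 1 ->
  u ^+ 2 / 4 <= normc (cis u - 1) ^+ 2.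
Proof.
move=> u1.
have -> : normc (cis u - 1) ^+ 2 = 4 * sin (u / 2) ^+ 2.
  rewrite /= subr0 sqr_sqrtr ?addr_ge0 ?sqr_ge0//.
  have -> : cos u = 1 - 2 * sin (u / 2) ^+ 2.
    rewrite [in LHS](_ : u = u / 2 + u / 2); last by lra.
    by rewrite cosD; have := cos2Dsin2 (u / 2); lra.
  have -> : sin u = 2 * (sin (u / 2) * cos (u / 2)).
    by rewrite [in LHS](_ : u = u / 2 + u / 2) ?sinD; lra.
  by rewrite !exprMn [cos _ ^+ 2](_ : _ = 1 - sin (u / 2) ^+ 2);
    [ring|have := cos2Dsin2 (u/2); lra].
wlog u0 : u u1 / 0 <= u.
  move=> H; have [/(H u u1)//|/ltW u0] := leP 0 u.
  have := H (- u); rewrite normrN oppr_ge0 sqrrN mulNr sinN sqrrN; exact.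
have u2 : u <= 1 by rewrite (le_trans _ u1)// ler_norm.
have h := @sin_ge_half _ (u / 2) ltac:(lra).
have : (u / 2 / 2) ^+ 2 <= sin (u / 2) ^+ 2 by rewrite ler_sqr ?nnegrE; lra.
rewrite !expr_div_n; lra.
Qed.

Lemma normc_cisB_le (R : realType) (u v : R) :
  normc (cis u - cis v) <= `|u - v|.
Proof.
have -> : cis u - cis v = cis v * (cis (u - v) - 1).
  by rewrite mulrBr -cisD mulr1; congr (cis _ - _); ring.
rewrite normcM normc_cis mul1r.
rewrite -ler_sqr ?nnegrE ?normc_ge0// real_normK ?num_real//.
set x := u - v.
rewrite /= subr0 sqr_sqrtr ?addr_ge0 ?sqr_ge0//.
by have := cos_ge x; have := cos2Dsin2 x; nra.
Qed.

(** * Dirichlet kernels *)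

Notation grid d N := {ffun 'I_d -> 'I_N}.

Definition dirichlet (R : realType) (M : nat) (u : R) : R[i] :=
  \sum_(m < M) cis (m%:R * u).

Lemma normc_dirichlet_le (R : realType) M (u : R) :
  normc (dirichlet M u) <= M%:R.
Proof.
apply: le_trans (normc_sum _ _ _) _.
under eq_bigr => i _ do rewrite normc_cis.
by rewrite sumr_const card_ord.
Qed.

Lemma dirichlet_telescope (R : realType) M (u : R) :
  (cis u - 1) * dirichlet M u = cis (M%:R * u) - 1.
Proof.
elim: M => [|M IH]; first by rewrite /dirichlet big_ord0 mul0r cis0 subrr mulr0.
rewrite /dirichlet big_ord_recr /= mulrDr -/(dirichlet M u) IH.
by rewrite -natr1 [(M%:R + 1) * u]mulrDl mul1r cisD; ring.
Qed.

(** The decay of the kernel away from 0: multiplying it by e^{iu} - 1 leaves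
    only the two end terms of the geometric sum. *)
Lemma sqr_normc_dirichlet_le (R : realType) M (u : R) : `|u| <= 1 ->
  u ^+ 2 * normc (dirichlet M u) ^+ 2 <= 16.
Proof.
move=> u1.
have h1 := normc_cisB1_ge u1.
have : normc (cis u - 1) ^+ 2 * normc (dirichlet M u) ^+ 2 <= 4.
  rewrite -exprMn -normcM dirichlet_telescope.
  have : normc (cis (M%:R * u) - 1) <= 2.
    by apply: le_trans (le_normcD _ _) _; rewrite normcN normc1 normc_cis.
  by have := normc_ge0 (cis (M%:R * u) - 1); nra.
by have := sqr_ge0 (normc (dirichlet M u)); nra.
Qed.

Lemma normc_dirichletN (R : realType) M (u : R) :
  normc (dirichlet M (- u)) = normc (dirichlet M u).
Proof.
have -> : dirichlet M (- u) = (((dirichlet M u)^*)%C).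
  by rewrite /dirichlet rmorph_sum; apply: eq_bigr => i _;
    rewrite mulrN -conj_cis.
by case: (dirichlet M u) => a b /=; rewrite sqrrN.
Qed.

(** Near 0 there is no cancellation: every term has argument at most 1 in
    absolute value, hence real part at least 1/2. *)
Lemma normc_dirichlet_ge (R : realType) Q (u : R) :
  Q%:R * `|u| <= 1 -> Q%:R / 2 <= normc (dirichlet Q u).
Proof.
move=> Qu.
apply: le_trans (normc_ge_absRe _); apply: le_trans (ler_norm _).
have -> : complex.Re (dirichlet Q u) = \sum_(q < Q) cos (q%:R * u).
  by rewrite /dirichlet (big_morph (@complex.Re R) (id1 := 0) (op1 := +%R))//
    => -[? ?] [? ?].
have -> : Q%:R / 2 = \sum_(q < Q) (1 / 2 : R).
  by rewrite sumr_const card_ord -mulr_natl; lra.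
apply: ler_sum => q _; apply: le_trans (cos_ge _).
suff : (q%:R * u) ^+ 2 <= 1 by lra.
rewrite -real_normK ?num_real// expr_le1// normrM normr_nat.
by apply: le_trans Qu; rewrite ler_wpM2r// ler_nat ltnW.
Qed.

Lemma sum_inj_le (R : numDomainType) (X Y : finType) (phi : X -> Y)
    (F : Y -> R) :
  injective phi -> (forall y, 0 <= F y) -> \sum_x F (phi x) <= \sum_y F y.
Proof.
move=> inj F0.
have -> : \sum_x F (phi x) = \sum_(y in [set phi x | x : X]%SET) F y.
  by rewrite big_imset//= => x y _ _; apply: inj.
by rewrite [leRHS](bigID (mem [set phi x | x : X]%SET))/= lerDl sumr_ge0.
Qed.

(** Comparable with r^-2 for r > 0, in a form that makes its sums telescope. *)
Definition quad_decay (R : realType) (r : nat) : R :=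
  ((r.+1)%:R * (r.+2)%:R)^-1.

Lemma quad_decay_ge0 (R : realType) r : 0 <= quad_decay R r.
Proof. by rewrite invr_ge0 mulr_ge0. Qed.

Lemma sum_quad_decay (R : realType) n : \sum_(r < n) quad_decay R r <= 1.
Proof.
suff -> : \sum_(r < n) quad_decay R r = 1 - (n.+1)%:R^-1 by rewrite gerBl
  invr_ge0.
elim: n => [|n IH]; first by rewrite big_ord0 invr1 subrr.
rewrite big_ord_recr /= IH /quad_decay -[n.+2%:R]natr1 -[n.+1%:R]natr1.
have := ler0n R n; move: (n%:R) => x x0.
by field; lra.
Qed.

Definition ndist (a b : nat) : nat := (a - b) + (b - a).

(** Each distance to c is attained at most once on either side of c. *)
Lemma sum_ndist_le (R : realType) (F : nat -> R) n K c :
  (forall r, 0 <= F r) -> (forall r, (r < n)%N -> (ndist c r < K)%N) ->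
  \sum_(r < n) F (ndist c r) <= 2 * \sum_(m < K) F m.
Proof.
move=> F0 lt.
pose phi (r : 'I_n) : 'I_K * bool := (Ordinal (lt r (ltn_ord r)), (c <= r)%N).
pose G (p : 'I_K * bool) := F p.1.
apply: (@le_trans _ _ (\sum_r G (phi r))) => //.
apply: le_trans (sum_inj_le (F := G) _ _) _.
- move=> r1 r2 [] /eqP e1 e2; apply/val_inj => /=.
  by move: e1 e2; rewrite /ndist; lia.
- by move=> p; apply: F0.
rewrite -(pair_bigA _ (fun (m : 'I_K) (_ : bool) => F m)) /=.
under eq_bigr => m _ do rewrite sumr_const card_bool.
by rewrite sumrMnl mulr_natl.
Qed.

Lemma sum_quad_decay_dist (R : realType) n c :
  \sum_(r < n) quad_decay R (ndist c r) <= 2.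
Proof.
apply: le_trans (sum_ndist_le (K := (n + c)%N) (@quad_decay_ge0 R) _) _.
  by move=> r rn; rewrite /ndist; lia.
by rewrite -[leRHS]mulr1 ler_wpM2l// sum_quad_decay.
Qed.

(** * Frostman weights on dyadic grids and exponential sums *)

(** The grid points index the cells of side 2^-n of the unit cube, and the
    points whose coordinates agree after division by 2^(n-l) form a dyadic cube
    of side 2^-l. With rho = 2^-s the bound rho^l is the s-th power of the side,
    so that this is the condition mu(Q) <= side(Q)^s down to the scale 2^-n. *)
Definition frostman (R : realType) (rho : R) (d n : nat)
    (w : grid d (2 ^ n) -> R) : Prop :=
  (forall a, 0 <= w a) /\
  forall l (c : 'I_d -> nat), (l <= n)%N ->
    \sum_(a : grid d (2 ^ n) | [forall i,
      (a i %/ 2 ^ (n - l))%N == c i]) w a <= rho ^+ l.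

Lemma frostman_mass (R : realType) (rho : R) d n (w : grid d (2 ^ n) -> R) :
  frostman rho w -> \sum_a w a <= 1.
Proof.
move=> [w0 wb]; have := wb 0%N (fun=> 0%N) (leq0n _).
rewrite expr0 subn0; apply: le_trans.
rewrite [leRHS](eq_bigl xpredT)// => a; apply/forallP => i.
by rewrite divn_small.
Qed.

(** A box that is not aligned with the dyadic grid meets at most two dyadic
    blocks in each coordinate direction. *)
Lemma frostman_box (R : realType) (rho : R) d n l (w : grid d (2 ^ n) -> R)
    (m : 'I_d -> nat) :
  frostman rho w -> (l <= n)%N ->
  \sum_(a : grid d (2 ^ n) | [forall i, (a i <= m i < a i + 2 ^ (n - l))%N]) w a
    <= 2 ^+ d * rho ^+ l.
Proof.
move=> [w0 wb] ln; set Q := (2 ^ (n - l))%N.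
have Q0 : (0 < Q)%N by rewrite expn_gt0.
(* The flag e i selects the block of m i or the preceding one. At block 0 the
   truncated subtraction makes both coincide, which is harmless here. *)
pose c (e : {ffun 'I_d -> bool}) (i : 'I_d) := (m i %/ Q - e i)%N.
apply: (@le_trans _ _ (\sum_(a : grid d (2 ^ n)) \sum_(e : {ffun 'I_d -> bool} |
    [forall i, (a i %/ Q)%N == c e i]) w a)).
  rewrite big_mkcond; apply: ler_sum => a _.
  case: ifPn => [/forallP am|_]; last by rewrite sumr_ge0.
  pose e := [ffun i => (a i %/ Q)%N != (m i %/ Q)%N].
  rewrite (bigD1 e) /= ?lerDl ?sumr_ge0//.
  apply/forallP => i; rewrite /c ffunE.
  have [e1|ne] := eqVneq (a i %/ Q)%N (m i %/ Q)%N; first by rewrite e1 subn0.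
  have /andP[h1 h2] := am i.
  have h3 : (a i %/ Q <= m i %/ Q)%N by rewrite leq_div2r.
  have h4 : (m i %/ Q <= a i %/ Q + 1)%N.
    have -> : (a i %/ Q + 1 = (a i + Q) %/ Q)%N by rewrite divnDr ?dvdnn//
      divnn Q0.
    by rewrite leq_div2r// ltnW.
  apply/eqP; move: ne h3 h4 => /eqP /=.
  by move: (a i %/ Q)%N (m i %/ Q)%N => u v; lia.
rewrite (exchange_big_dep xpredT)//=.
apply: (@le_trans _ _ (\sum_(e : {ffun 'I_d -> bool}) rho ^+ l)).
  by apply: ler_sum => e _; apply: wb.
by rewrite sumr_const card_ffun card_bool card_ord -natrX mulr_natl.
Qed.

(** Schur test for a product kernel: each block has mass at most rho^l, and the
    remaining sum over blocks factors into one-dimensional convergent sums. *)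
Lemma frostman_quad_decay (R : realType) (rho : R) d n l
    (w : grid d (2 ^ n) -> R) (x : 'I_d -> nat) :
  0 <= rho -> frostman rho w -> (l <= n)%N ->
  \sum_(b : grid d (2 ^ n)) w b * \prod_i quad_decay R (ndist (x i) (b i %/ 2 ^
    (n - l))%N)
    <= 2 ^+ d * rho ^+ l.
Proof.
move=> r0 [w0 wb] ln; set Q := (2 ^ (n - l))%N.
have lt (b : grid d (2 ^ n)) i : (b i %/ Q < 2 ^ l)%N.
  by rewrite ltn_divLR ?expn_gt0// -expnD subnKC.
pose blk b : grid d (2 ^ l) := [ffun i => Ordinal (lt b i)].
rewrite (partition_big blk xpredT)//=.
apply: (@le_trans _ _ (\sum_(c : grid d (2 ^ l))
    (\prod_i quad_decay R (ndist (x i) (c i))) * rho ^+ l)).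
  apply: ler_sum => c _.
  have -> : \sum_(b | blk b == c) w b * \prod_i quad_decay R (ndist (x i) (b i
    %/ Q)%N) =
     (\prod_i quad_decay R (ndist (x i) (c i))) * \sum_(b | blk b == c) w b.
    rewrite mulr_sumr; apply: eq_bigr => b /eqP <-; rewrite mulrC;
      congr (_ * _).
    by apply: eq_bigr => i _; rewrite ffunE.
  rewrite ler_wpM2l ?prodr_ge0// => [i _|]; first exact: quad_decay_ge0.
  apply: le_trans (wb l (fun i => c i) ln).
  rewrite le_eqVlt; apply/orP; left; apply/eqP; apply: eq_bigl => b.
  apply/eqP/forallP => [<- i|H]; first by rewrite ffunE.
  by apply/ffunP => i; apply/val_inj; rewrite ffunE /=; apply/eqP.
rewrite -mulr_suml ler_wpM2r ?exprn_ge0//.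
rewrite -(bigA_distr_bigA (fun i (r : 'I_(2 ^ l)) => quad_decay R (ndist (x i)
  r))) /=.
rewrite -[d in leRHS]card_ord -prodr_const; apply: ler_prod => i _.
by rewrite sum_quad_decay_dist sumr_ge0// => r _; rewrite quad_decay_ge0.
Qed.

(** The frequency t ranges over real vectors, as differences of grid points and
    shifted grid points are both used. *)
Definition expsum (R : realType) d N (beta : grid d N -> R[i]) (h : R)
    (t : 'I_d -> R) : R[i] :=
  \sum_(b : grid d N) beta b * cis (h * \sum_i t i * (b i)%:R).

(** A value of an exponential sum whose coefficients live on bounded points is
    a sum of nearby values of another such sum: adding up over the shifts q
    multiplies the coefficient of b by a product of Dirichlet kernels, and
    dividing by that product beforehand undoes it. This is how values at the
    points of a sparse set get controlled by values on a full grid. *)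
Lemma expsum_smear (R : realType) d N Q (alpha : grid d N -> R[i]) (h : R)
    (t : 'I_d -> R) :
  (forall b : grid d N, \prod_i dirichlet Q (h * (b i)%:R) != 0) ->
  expsum alpha h t = \sum_(q : grid d Q)
    expsum (fun b => alpha b / \prod_i dirichlet Q (h * (b i)%:R)) h
      (fun i => t i + (q i)%:R).
Proof.
move=> nz; rewrite /expsum exchange_big /=; apply: eq_bigr => b _.
rewrite -mulr_sumr -mulrA; congr (_ * _).
transitivity ((\prod_i dirichlet Q (h * (b i)%:R))^-1 *
  (cis (h * \sum_i t i * (b i)%:R) *
   \sum_(q : grid d Q) \prod_i cis ((q i)%:R * (h * (b i)%:R)))).
  rewrite -(bigA_distr_bigA (fun i (r : 'I_Q) => cis (r%:R * (h * (b i)%:R))))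
    /=.
  by rewrite mulrCA mulVf ?mulr1.
congr (_ * _); rewrite [LHS]mulr_sumr; apply: eq_bigr => q _.
rewrite -cis_sum -cisD; congr cis.
rewrite !mulr_sumr -big_split; apply: eq_bigr => i _ /=; ring.
Qed.

(** Every point m of the box [0, M)^d is a difference p - q of points of
    [0, 2M)^d in at least M^d ways. Summing over p and q instead of m only
    increases the sum, and the sum over p and q of e(p - q) is a squared
    Dirichlet kernel, so that no cancellation has to be tracked afterwards. *)
Lemma expsum_box (R : realType) d N M (beta : grid d N -> R[i]) (h : R) :
  \sum_(m : grid d M) normc (expsum beta h (fun i => (m i)%:R)) ^+ 2 *+ (M ^ d)
  <= \sum_(b : grid d N) \sum_(b' : grid d N) normc (beta b) * normc (beta b') *
     \prod_i normc (dirichlet (2 * M) (h * ((b i)%:R - (b' i)%:R))) ^+ 2.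
Proof.
pose G (p q : grid d (2 * M)) :=
  normc (expsum beta h (fun i => (p i)%:R - (q i)%:R)) ^+ 2.
apply: (@le_trans _ _ (\sum_p \sum_q G p q)).
  have -> : (M ^ d)%N = #|{: grid d M}| by rewrite card_ffun !card_ord.
  under eq_bigr => m _ do rewrite -sumr_const.
  rewrite !pair_bigA /=.
  have lt1 (m q : 'I_M) : (m + q < 2 * M)%N.
    by have := ltn_ord m; have := ltn_ord q; lia.
  have lt2 (q : 'I_M) : (q < 2 * M)%N by have := ltn_ord q; lia.
  pose phi (x : grid d M * grid d M) : grid d (2 * M) * grid d (2 * M) :=
    ([ffun i => Ordinal (lt1 (x.1 i) (x.2 i))],
      [ffun i => Ordinal (lt2 (x.2 i))]).
  apply: (@le_trans _ _ (\sum_x G (phi x).1 (phi x).2)).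
    rewrite le_eqVlt; apply/orP; left; apply/eqP; apply: eq_bigr => -[m q] _.
    rewrite /G; congr (normc (expsum _ _ _) ^+ 2); apply/funext => i /=.
    by rewrite !ffunE /= natrD addrK.
  apply: (sum_inj_le (F := fun x => G x.1 x.2)) => [[m q] [m' q']|[p q]];
    last exact: sqr_ge0.
  move=> [/ffunP e1 /ffunP e2].
  have eq_q : q = q'.
    by apply/ffunP => i; have := e2 i; rewrite !ffunE => -[] /val_inj.
  rewrite -eq_q in e1 *; congr pair.
  by apply/ffunP => i; have := e1 i; rewrite !ffunE => -[] /addIn /val_inj.
have E : ((\sum_p \sum_q G p q)%:C)%C =
  \sum_b \sum_b' beta b * ((beta b')^*)%C *
    ((\prod_i dirichlet (2 * M) (h * ((b i)%:R - (b' i)%:R))) *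
     (\prod_i dirichlet (2 * M) (- (h * ((b i)%:R - (b' i)%:R))))).
  transitivity (\sum_(p : grid d (2 * M)) \sum_(q : grid d (2 * M))
     \sum_b \sum_b' beta b * ((beta b')^*)%C *
       ((\prod_i cis ((p i)%:R * (h * ((b i)%:R - (b' i)%:R)))) *
        (\prod_i cis ((q i)%:R * (- (h * ((b i)%:R - (b' i)%:R))))))).
    rewrite rmorph_sum; apply: eq_bigr => p _.
    rewrite rmorph_sum; apply: eq_bigr => q _.
    apply: (etrans (sqr_normc_sum _)); apply: eq_bigr => b _;
      apply: eq_bigr => b' _.
    rewrite rmorphM -!mulrA; congr (_ * _); rewrite mulrCA; congr (_ * _).
    rewrite [X in _ * X]conj_cis -!cis_sum -!cisD; congr cis.
    rewrite !mulr_sumr -sumrN -!big_split; apply: eq_bigr => i _ /=; ring.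
  under eq_bigr => p _ do rewrite exchange_big.
  rewrite exchange_big; apply: eq_bigr => b _ /=.
  under eq_bigr => p _ do rewrite exchange_big.
  rewrite exchange_big; apply: eq_bigr => b' _ /=.
  rewrite !(bigA_distr_bigA (fun i (r : 'I_(2 * M)) => cis _)).
  rewrite mulr_suml mulr_sumr; apply: eq_bigr => p _.
  by rewrite !mulr_sumr.
have -> : \sum_p \sum_q G p q = normc ((\sum_p \sum_q G p q)%:C)%C.
  by rewrite normc_real ger0_norm// !sumr_ge0// => p _;
    rewrite !sumr_ge0// => q _; apply: sqr_ge0.
rewrite E; apply: le_trans (normc_sum _ _ _) _; apply: ler_sum => b _.
apply: le_trans (normc_sum _ _ _) _; apply: ler_sum => b' _.
rewrite !normcM !normc_prod le_eqVlt; apply/orP; left; apply/eqP.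
congr (_ * _ * _); first by case: (beta b') => u v /=; rewrite sqrrN.
rewrite -big_split; apply: eq_bigr => i _ /=.
by rewrite normc_dirichletN expr2.
Qed.

(** * The bilinear estimate *)

Lemma natr_ndist (R : realType) (a b : nat) :
  (ndist a b)%:R = `|a%:R - b%:R| :> R.
Proof.
rewrite /ndist; have [ab|/ltnW ba] := leqP a b.
  by rewrite (eqP ab) add0n natrB// distrC ger0_norm// subr_ge0 ler_nat.
by rewrite (eqP ba) addn0 natrB// ger0_norm// subr_ge0 ler_nat.
Qed.

(** Points whose blocks differ by r are at distance greater than (r - 1) Q,
    which is at least r Q / 2 once r is at least 2. *)
Lemma ndist_block Q a b : (0 < Q)%N ->
  (2 <= ndist (a %/ Q) (b %/ Q))%N ->
  (ndist (a %/ Q) (b %/ Q) * Q <= 2 * ndist a b)%N.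
Proof.
move=> Q0.
have := divn_eq a Q; have := ltn_pmod a Q0.
have := divn_eq b Q; have := ltn_pmod b Q0.
move: (a %/ Q)%N (a %% Q)%N (b %/ Q)%N (b %% Q)%N => x s y t.
by rewrite /ndist => ht -> hs ->; nia.
Qed.

Lemma same_block_lt Q a b : (0 < Q)%N -> (a %/ Q = b %/ Q)%N -> (a < b + Q)%N.
Proof.
move=> Q0 ab; rewrite {1}(divn_eq a Q) {1}(divn_eq b Q) ab -addnA ltn_add2l.
by rewrite (leq_trans (ltn_pmod a Q0))// leq_addl.
Qed.

(** Neighbouring blocks get the trivial bound. Blocks at distance r correspond
    to an argument u of size at least lam r / 2^n, where the kernel is at most
    4 / |u|; the restriction on lam keeps |u| below 1, within the range where
    this decay holds. *)
Lemma dirichlet_quad_decay (R : realType) (lam h : R) n l j a b :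
  0 < lam <= 1/4 -> (l <= n)%N -> (2 ^ l <= j < 2 ^ l.+1)%N ->
  `|h| = 2 * lam * j%:R / (2 ^ n)%:R ^+ 2 ->
  (a < 2 ^ n)%N -> (b < 2 ^ n)%N ->
  normc (dirichlet (2 * (2 * 2 ^ n)) (h * (a%:R - b%:R))) ^+ 2 <=
  48 / lam ^+ 2 * (2 ^ n)%:R ^+ 2 *
    quad_decay R (ndist (a %/ 2 ^ (n - l)) (b %/ 2 ^ (n - l))).
Proof.
move=> /andP[lam0 lam4] ln /andP[lj jl] hE aN bN.
set N := (2 ^ n)%N; set Q := (2 ^ (n - l))%N; set u := h * _.
have N0 : (0 : R) < N%:R by rewrite ltr0n expn_gt0.
have QN : (2 ^ l * Q = N)%N by rewrite -expnD subnKC.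
have Q0 : (0 < Q)%N by rewrite expn_gt0.
set D := dirichlet _ _; set r := ndist _ _.
have D0 : 0 <= normc D ^+ 2 by apply: sqr_ge0.
have lam2 : 0 < lam ^+ 2 by rewrite exprn_gt0.
have lamV : 16 <= (lam ^+ 2)^-1.
  by rewrite -[leLHS]invrK lef_pV2 ?posrE//; nra.
have uE : `|u| = 2 * lam * j%:R / N%:R ^+ 2 * (ndist a b)%:R.
  by rewrite normrM hE natr_ndist.
have [r2|r2] := ltnP r 2.
  have kr : 1 / 6 <= quad_decay R r.
    by move: r2; case: r => [|[|]]//= _; rewrite /quad_decay; lra.
  have : normc D <= 4 * N%:R.
    by apply: le_trans (normc_dirichlet_le _ _) _; rewrite !natrM mulrA -natrM.
  have := normc_ge0 D => D1 D2.
  have : normc D ^+ 2 <= 16 * N%:R ^+ 2 by nra.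
  have : 16 * N%:R ^+ 2 <= 48 / lam ^+ 2 * N%:R ^+ 2 * (1 / 6).
    have := sqr_ge0 (N%:R : R); nra.
  have : 48 / lam ^+ 2 * N%:R ^+ 2 * (1 / 6) <= 48 / lam ^+ 2 * N%:R ^+ 2 *
    quad_decay R r.
    by rewrite ler_wpM2l// mulr_ge0 ?sqr_ge0// mulr_ge0//; lra.
  lra.
have u1 : `|u| <= 1.
  have jN : (j <= 2 * N)%N.
    by apply: ltnW; apply: leq_trans jl _; rewrite -expnS leq_pexp2l.
  have abN : (ndist a b <= N)%N by move: aN bN; rewrite /ndist -/N; lia.
  have : j%:R * (ndist a b)%:R <= 2 * N%:R * N%:R :> R.
    by rewrite -!natrM ler_nat; apply: leq_mul.
  move=> H; rewrite uE mulrAC ler_pdivrMr ?exprn_gt0// mul1r.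
  apply: (@le_trans _ _ (2 * lam * (2 * N%:R * N%:R))).
    by rewrite -[leLHS]mulrA ler_wpM2l//; lra.
  have := sqr_ge0 (N%:R : R); nra.
have ul : lam * r%:R / N%:R <= `|u|.
  rewrite uE.
  have H : (r * N <= 2 * j * ndist a b)%N.
    have H1 := ndist_block Q0 r2.
    rewrite -QN mulnCA (_ : 2 * j * ndist a b = j * (2 * ndist a b))%N;
      last by ring.
    exact: leq_mul.
  rewrite ler_pdivrMr//.
  have {}H : r%:R * N%:R <= 2 * j%:R * (ndist a b)%:R :> R by rewrite -!natrM
    ler_nat.
  have -> : 2 * lam * j%:R / N%:R ^+ 2 * (ndist a b)%:R * N%:R =
     lam * (2 * j%:R * (ndist a b)%:R) / N%:R by field; lra.
  by rewrite ler_pdivlMr// -[leLHS]mulrA ler_wpM2l// ltW.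
have kr : r%:R ^- 2 <= 3 * quad_decay R r :> R.
  rewrite /quad_decay -!natrM; have r0 : (0 < r)%N by apply: leq_trans r2.
  rewrite -[3]invrK -invfM lef_pV2 ?posrE ?mulr_gt0 ?invr_gt0 ?exprn_gt0 ?ltr0n
    ?muln_gt0//.
  rewrite mulrC ler_pdivrMr// -natrX -natrM ler_nat.
  by move: r2; nia.
have := sqr_normc_dirichlet_le (2 * (2 * N)) u1; rewrite -/D => H.
have r0 : 0 < r%:R :> R by rewrite ltr0n (leq_trans _ r2).
have X : (lam * r%:R / N%:R) ^+ 2 * normc D ^+ 2 <= 16.
  apply: le_trans H; rewrite ler_wpM2r// -[leRHS]real_normK ?num_real//.
  by rewrite ler_sqr ?nnegrE// ltW// divr_gt0// mulr_gt0.
have -> : normc D ^+ 2 = ((lam * r%:R / N%:R) ^+ 2 * normc D ^+ 2) *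
    ((lam ^+ 2)^-1 * N%:R ^+ 2 * r%:R ^- 2).
  by field; rewrite !gt_eqF.
apply: (@le_trans _ _ (16 * ((lam ^+ 2)^-1 * N%:R ^+ 2 * (3 * quad_decay R
  r)))).
  apply: ler_pM => //; do ?[apply: mulr_ge0];
    rewrite ?invr_ge0 ?sqr_ge0// ?(ltW lam0) ?normc_ge0//.
  by rewrite ler_wpM2l// mulr_ge0 ?invr_ge0 ?sqr_ge0.
by rewrite le_eqVlt; apply/orP; left; apply/eqP; ring.
Qed.

Definition gdist2 (R : realType) d N (a b : grid d N) : R :=
  \sum_i ((a i)%:R - (b i)%:R) ^+ 2.

Definition bilinear_const (R : realType) (d : nat) (lam : R) : R :=
  (384 / lam ^+ 2) ^+ d.

Lemma bilinear_const_ge0 (R : realType) (d : nat) (lam : R) :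
  0 <= bilinear_const d lam.
Proof.
by apply: exprn_ge0; apply: divr_ge0; [exact: ler0n|exact: sqr_ge0].
Qed.

(** The operator with kernel e(j |x - y|^2) between two sets of dimension s has
    squared norm of order j^(d - 2s), here at the frequencies j of order 2^l.
    Expanding |x - y|^2 leaves, up to unimodular factors in x and in y, the
    kernel e(x . y). The sum over y is then a trigonometric sum in x which is
    essentially constant on cubes of side 1/j: averaging over such cubes (of Q
    grid steps) and the Frostman condition in x bound the left-hand side by
    rho^l times a mean square over a full box of frequencies. There the sums
    over y are nearly orthogonal, and the Frostman condition in y gives the
    second factor rho^l, while 2^(d l) counts the cubes. *)
Lemma bilinear_estimate (R : realType) (rho lam : R) d n l j
    (w w' : grid d (2 ^ n) -> R) :
  0 <= rho -> 0 < lam <= 1/4 -> frostman rho w -> frostman rho w' ->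
  (l <= n)%N -> (2 ^ l <= j < 2 ^ l.+1)%N ->
  \sum_a w a * normc (\sum_b ((w' b)%:C)%C *
     cis (j%:R * (lam * gdist2 R a b / (2 ^ n)%:R ^+ 2))) ^+ 2
  <= bilinear_const d lam * (2 ^+ d * rho ^+ 2) ^+ l.
Proof.
move=> rho0 lamP fw fw' ln lj.
have [lam0 lam4] : 0 < lam /\ lam <= 1/4 by apply/andP.
set N := (2 ^ n)%N; pose Q := (2 ^ (n - l))%N.
have N0 : (0 : R) < N%:R by rewrite ltr0n expn_gt0.
have QN : (2 ^ l * Q = N)%N by rewrite -expnD subnKC.
have Q0 : (0 : R) < Q%:R by rewrite ltr0n expn_gt0.
(* The kernel is cis (th * |a - b|^2). *)
pose th := j%:R * lam / N%:R ^+ 2; pose h := - (2 * th).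
have th0 : 0 <= th by rewrite /th divr_ge0 ?sqr_ge0// mulr_ge0// ltW.
have hE : `|h| = 2 * lam * j%:R / N%:R ^+ 2.
  by rewrite normrN ger0_norm; [rewrite /th; ring|rewrite mulr_ge0].
(* The cross term of |a - b|^2 gives the frequency h, and the square of b is
   absorbed in the coefficients. *)
pose alpha (b : grid d N) := ((w' b)%:C)%C * cis (th * \sum_i (b i)%:R ^+ 2).
pose chi (b : grid d N) := \prod_i dirichlet Q (h * (b i)%:R).
pose beta b := alpha b / chi b.
have chi_ge b : (Q%:R / 2) ^+ d <= normc (chi b).
  rewrite normc_prod -[d in leLHS]card_ord -prodr_const; apply: ler_prod => i _.
  rewrite divr_ge0 ?(ltW Q0)//= normc_dirichlet_ge//.
  rewrite normrM hE normr_nat.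
  have H : (Q * j * b i <= 2 * N * N)%N.
    have bi : (b i <= N)%N by apply: ltnW.
    apply: leq_mul => //; case/andP: lj => _ /ltnW jl.
    apply: leq_trans (leq_mul (leqnn Q) jl) _.
    by rewrite expnS mulnCA [(Q * _)%N]mulnC QN.
  have {}H : Q%:R * j%:R * (b i)%:R <= 2 * N%:R * N%:R :> R.
    by rewrite -!natrM ler_nat.
  have -> : Q%:R * (2 * lam * j%:R / N%:R ^+ 2 * (b i)%:R) =
    2 * lam * (Q%:R * j%:R * (b i)%:R) / N%:R ^+ 2 :> R by field; lra.
  rewrite ler_pdivrMr ?exprn_gt0// mul1r.
  apply: (@le_trans _ _ (2 * lam * (2 * N%:R * N%:R))).
    by rewrite ler_wpM2l//; lra.
  have := sqr_ge0 (N%:R : R); nra.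
have Qd : 0 < (Q%:R / 2) ^+ d :> R by rewrite exprn_gt0// divr_gt0.
have chi0 b : chi b != 0.
  apply/negP => /eqP E; have := chi_ge b; rewrite E normc0.
  by rewrite leNgt Qd.
have beta_le b : normc (beta b) <= w' b * (2 / Q%:R) ^+ d.
  rewrite normcM normcV normcM normc_cis mulr1 normc_real.
  rewrite ger0_norm ?(fw'.1)// ler_wpM2l ?(fw'.1)//.
  by rewrite -[2 / _]invf_div exprVn lef_pV2 ?posrE// (lt_le_trans Qd).
pose g (t : 'I_d -> R) := expsum beta h t.
have step1 (a : grid d N) : normc (\sum_b ((w' b)%:C)%C *
     cis (j%:R * (lam * gdist2 R a b / N%:R ^+ 2))) =
   normc (\sum_(q : grid d Q) g (fun i => (a i)%:R + (q i)%:R)).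
  rewrite /g -expsum_smear//.
  have -> : \sum_b ((w' b)%:C)%C * cis (j%:R * (lam * gdist2 R a b / N%:R ^+
    2)) =
    cis (th * \sum_i (a i)%:R ^+ 2) * expsum alpha h (fun i => (a i)%:R).
    rewrite /expsum [RHS]mulr_sumr; apply: eq_bigr => b _.
    rewrite /alpha [RHS]mulrCA -[RHS]mulrA; congr (_ * _).
    rewrite -!cisD; congr cis.
    have -> : gdist2 R a b = \sum_i (a i)%:R ^+ 2 + \sum_i (b i)%:R ^+ 2 -
        2 * \sum_i (a i)%:R * (b i)%:R.
      rewrite mulr_sumr -big_split -sumrB; apply: eq_bigr => i _ /=; ring.
    by rewrite /h /th; ring.
  by rewrite normcM normc_cis mul1r.
pose G (m : grid d (2 * N)) := normc (g (fun i => (m i)%:R)) ^+ 2.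
have G0 m : 0 <= G m by apply: sqr_ge0.
have step2 (a : grid d N) : normc (\sum_b ((w' b)%:C)%C *
     cis (j%:R * (lam * gdist2 R a b / N%:R ^+ 2))) ^+ 2 <=
   Q%:R ^+ d * \sum_m G m *+ [forall i, (a i <= m i < a i + Q)%N].
  rewrite step1; apply: le_trans (sqr_normc_sum_le _) _.
  rewrite card_ffun !card_ord natrX ler_wpM2l ?exprn_ge0//.
  have QleN : (Q <= N)%N by rewrite leq_pexp2l// leq_subr.
  have lt (x : 'I_N) (q : 'I_Q) : (x + q < 2 * N)%N.
    by have := ltn_ord x; have := ltn_ord q; move: QleN; lia.
  pose phi (q : grid d Q) : grid d (2 * N) := [ffun i => Ordinal (lt (a i) (q
    i))].
  apply: le_trans (sum_inj_le (phi := phi) (F := fun m => G m *+ [forall i,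
    (a i <= m i < a i + Q)%N]) _ _).
  - rewrite le_eqVlt; apply/orP; left; apply/eqP; apply: eq_bigr => q _.
    have -> : [forall i, (a i <= phi q i < a i + Q)%N].
      by apply/forallP => i; rewrite ffunE /= leq_addr ltn_add2l ltn_ord.
    rewrite mulr1n /G; congr (normc (g _) ^+ 2); apply/funext => i.
    by rewrite ffunE /= natrD.
  - move=> q q' /ffunP e; apply/ffunP => i.
    by have := e i; rewrite !ffunE => -[] /addnI /val_inj.
  - by move=> m; rewrite mulrn_wge0.
have step3 : \sum_a w a * normc (\sum_b ((w' b)%:C)%C *
     cis (j%:R * (lam * gdist2 R a b / N%:R ^+ 2))) ^+ 2 <=
   Q%:R ^+ d * (2 ^+ d * rho ^+ l) * \sum_m G m.
  apply: (@le_trans _ _ (\sum_a w a * (Q%:R ^+ d *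
      \sum_m G m *+ [forall i, (a i <= m i < a i + Q)%N]))).
    by apply: ler_sum => a _; rewrite ler_wpM2l// (fw.1).
  under eq_bigr => a _ do rewrite mulrCA mulr_sumr.
  rewrite -mulr_sumr -mulrA ler_wpM2l ?exprn_ge0//.
  rewrite exchange_big [leRHS]mulr_sumr; apply: ler_sum => m _ /=.
  under eq_bigr => a _ do rewrite mulrnAr -mulrnAl mulrC.
  rewrite -mulr_sumr mulrC ler_wpM2r//.
  under eq_bigr => a _ do rewrite mulrb.
  rewrite -big_mkcond /=.
  exact: (frostman_box (fun i => m i) fw ln).
apply: (le_trans step3).
have step4 : \sum_m G m <= (2 * N%:R) ^- d * ((2 / Q%:R) ^+ d * (2 / Q%:R) ^+ d
  *
    (48 / lam ^+ 2 * N%:R ^+ 2) ^+ d * (2 ^+ d * rho ^+ l)).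
  rewrite mulrC ler_pdivlMr ?exprn_gt0 ?mulr_gt0//.
  have := expsum_box (2 * N) beta h.
  rewrite sumrMnl -[X in X <= _ ->
    _]mulr_natr (natrX _ (2 * N) d) (natrM _ 2 N) => /le_trans; apply.
  apply: (@le_trans _ _ (\sum_b \sum_b' (w' b * (2 / Q%:R) ^+ d) * (w' b' * (2
    / Q%:R) ^+ d) *
     \prod_(i < d) (48 / lam ^+ 2 * N%:R ^+ 2 *
        quad_decay R (ndist (b i %/ Q)%N (b' i %/ Q)%N)))).
    apply: ler_sum => b _; apply: ler_sum => b' _.
    apply: ler_pM; rewrite ?mulr_ge0 ?normc_ge0 ?prodr_ge0//.
    - by move=> i _; apply: sqr_ge0.
    - by apply: ler_pM; rewrite ?normc_ge0.
    - apply: ler_prod => i _; rewrite sqr_ge0 /=.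
      exact: (dirichlet_quad_decay lamP ln lj hE (ltn_ord _) (ltn_ord _)).
  set A : R := (2 / Q%:R) ^+ d * (2 / Q%:R) ^+ d * _.
  have A0 : 0 <= A.
    rewrite /A; do ?[apply: mulr_ge0|apply: exprn_ge0] => //;
      by rewrite invr_ge0 ?sqr_ge0 ?ltW.
  apply: (@le_trans _ _ (\sum_b (A * w' b) * \sum_(b' : grid d N) w' b' *
      \prod_i quad_decay R (ndist (b i %/ Q)%N (b' i %/ Q)%N))).
    rewrite le_eqVlt; apply/orP; left; apply/eqP; apply: eq_bigr => b _.
    rewrite [RHS]mulr_sumr; apply: eq_bigr => b' _.
    by rewrite big_split /= prodr_const card_ord /A; ring.
  apply: (@le_trans _ _ (\sum_b (A * w' b) * (2 ^+ d * rho ^+ l))).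
    apply: ler_sum => b _; rewrite ler_wpM2l ?(mulr_ge0 A0) ?(fw'.1)//.
    exact: (frostman_quad_decay (fun i => b i %/ Q)%N rho0 fw' ln).
  rewrite -mulr_suml -mulr_sumr ler_wpM2r ?mulr_ge0 ?exprn_ge0//.
  by rewrite -[leRHS]mulr1 ler_wpM2l// (frostman_mass fw').
apply: (@le_trans _ _ (Q%:R ^+ d * (2 ^+ d * rho ^+ l) *
  ((2 * N%:R) ^- d * ((2 / Q%:R) ^+ d * (2 / Q%:R) ^+ d *
    (48 / lam ^+ 2 * N%:R ^+ 2) ^+ d * (2 ^+ d * rho ^+ l))))).
  by rewrite ler_wpM2l// !mulr_ge0 ?exprn_ge0// ltW.
rewrite le_eqVlt; apply/orP; left; apply/eqP.
transitivity ((Q%:R * 2 * (2 * N%:R)^-1 * (2 / Q%:R) * (2 / Q%:R) *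
   (48 / lam ^+ 2 * N%:R ^+ 2) * 2) ^+ d * (rho ^+ l * rho ^+ l)).
  by rewrite !(exprMn, exprVn, invfM); ring.
have -> : (2 ^+ d * rho ^+ 2) ^+ l = (2 ^+ l) ^+ d * (rho ^+ l * rho ^+ l).
  by rewrite exprMn -!exprM [(d * l)%N]mulnC mul2n -addnn exprD.
rewrite /bilinear_const [RHS]mulrA -[in RHS]exprMn; congr (_ ^+ d * _).
have -> : N%:R = 2 ^+ l * Q%:R :> R by rewrite -QN natrM natrX.
by field; rewrite !gt_eqF// exprn_gt0.
Qed.

(** * Counting values with the Fejer kernel *)

Definition charsum (R : realType) (T : finType) (W Phi : T -> R)
    (r : R) : R[i] :=
  \sum_P ((W P)%:C)%C * cis (r * Phi P).

(** The values Phi P weighted by N times a Fejer kernel centred at v: a smooth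
    count of how often v is attained, at scale 1/N. *)
Definition fejer_count (R : realType) (T : finType) (W Phi : T -> R) N
    (v : R) : R :=
  \sum_P W P * normc (dirichlet N (Phi P - v)) ^+ 2.

Lemma normc_charsumN (R : realType) (T : finType) (W Phi : T -> R) r :
  normc (charsum W Phi (- r)) = normc (charsum W Phi r).
Proof.
have -> : charsum W Phi (- r) = ((charsum W Phi r)^*)%C.
  rewrite /charsum rmorph_sum; apply: eq_bigr => P _.
  rewrite rmorphM mulNr -conj_cis; congr (_ * _).
  by rewrite /= /real_complex_def oppr0.
by case: (charsum _ _ _) => a b /=; rewrite sqrrN.
Qed.

Lemma normc_charsum_ndist (R : realType) (T : finType) (W Phi : T -> R)
    (p q : nat) :
  normc (charsum W Phi (p%:R - q%:R)) = normc (charsum W Phi (ndist p q)%:R).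
Proof.
rewrite natr_ndist; case: ger0P => // _.
by rewrite normc_charsumN.
Qed.

Lemma fejer_countE (R : realType) (T : finType) (W Phi : T -> R) N (v : R) :
  ((fejer_count W Phi N v)%:C)%C = \sum_(p < N) \sum_(q < N)
     charsum W Phi (p%:R - q%:R) * cis (- ((p%:R - q%:R) * v)).
Proof.
transitivity (\sum_P \sum_(p < N) \sum_(q < N)
  ((W P)%:C)%C * cis ((p%:R - q%:R) * Phi P) * cis (- ((p%:R - q%:R) * v))).
  rewrite rmorph_sum; apply: eq_bigr => P _.
  rewrite rmorphM /=.
  rewrite [X in _ * X](sqr_normc_sum (fun p : 'I_N => cis (p%:R * (Phi P -
    v)))).
  rewrite mulr_sumr; apply: eq_bigr => p _; rewrite mulr_sumr;
    apply: eq_bigr => q _.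
  rewrite [X in _ * (_ * X)]conj_cis -mulrA -!cisD; congr (_ * cis _); ring.
rewrite exchange_big; apply: eq_bigr => p _; rewrite exchange_big;
  apply: eq_bigr => q _.
by rewrite -mulr_suml.
Qed.

(** The Fourier coefficients of the count are those of the distribution of Phi,
    so that its modulus of continuity only depends on their decay. *)
Lemma fejer_count_diff (R : realType) (T : finType) (W Phi : T -> R) N
    (u v eta : R) :
  `|u - v| <= eta ->
  `|fejer_count W Phi N u - fejer_count W Phi N v| <=
  N%:R * (2 * \sum_(r < N) normc (charsum W Phi r%:R) * Num.min 2 (r%:R * eta)).
Proof.
move=> uv; have eta0 : 0 <= eta by apply: le_trans uv.
rewrite -normc_real rmorphB [X in X - _]fejer_countE [X in _ - X]fejer_countE
  -sumrB.
apply: le_trans (normc_sum _ _ _) _.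
apply: (@le_trans _ _ (\sum_(p < N) (2 * \sum_(r < N) normc (charsum W Phi
  r%:R) * Num.min 2 (r%:R * eta)))); last first.
  by rewrite sumr_const card_ord [leRHS]mulr_natl.
apply: ler_sum => p _; rewrite -sumrB.
apply: le_trans (normc_sum _ _ _) _.
pose F r : R := normc (charsum W Phi r%:R) * Num.min 2 (r%:R * eta).
apply: le_trans (sum_ndist_le (F := F) (c := p) (n := N) _ _); last 2 first.
- by move=> r; rewrite mulr_ge0 ?normc_ge0// le_min ler0n mulr_ge0.
- by move=> r rN; have := ltn_ord p; rewrite /ndist; lia.
apply: ler_sum => q _; rewrite -mulrBr normcM normc_charsum_ndist.
rewrite ler_wpM2l ?normc_ge0// le_min; apply/andP; split.
  by apply: le_trans (le_normcD _ _) _; rewrite normcN !normc_cis.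
apply: le_trans (normc_cisB_le _ _) _.
rewrite -opprB normrN opprK addrC -mulrBr normrM natr_ndist ler_wpM2l//.
Qed.

(** Positive definiteness of the Fejer kernel: the left-hand side is the
    contribution of the frequency 0 (the diagonal p = q) to a sum of squares. *)
Lemma fejer_count_mean (R : realType) (T : finType) (W Phi : T -> R) N :
  N%:R * (\sum_P W P) ^+ 2 <= \sum_P W P * fejer_count W Phi N (Phi P).
Proof.
have E : ((\sum_P W P * fejer_count W Phi N (Phi P))%:C)%C =
   ((\sum_(p < N) \sum_(q < N) normc (charsum W Phi (p%:R - q%:R)) ^+ 2)%:C)%C.
  rewrite rmorph_sum.
  transitivity (\sum_P \sum_(p < N) \sum_(q < N) ((W P)%:C)%C * (charsum W Phi
    (p%:R - q%:R) *
      cis (- ((p%:R - q%:R) * Phi P)))).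
    apply: eq_bigr => P _; rewrite rmorphM /= fejer_countE mulr_sumr.
    by apply: eq_bigr => p _; rewrite mulr_sumr.
  rewrite rmorph_sum exchange_big; apply: eq_bigr => p _.
  rewrite rmorph_sum exchange_big; apply: eq_bigr => q _ /=.
  rewrite [RHS]sqr_normcE.
  have -> : (((charsum W Phi (p%:R - q%:R))^*)%C) =
    \sum_P ((W P)%:C)%C * cis (- ((p%:R - q%:R) * Phi P)).
    rewrite /charsum rmorph_sum; apply: eq_bigr => P _.
    rewrite rmorphM -conj_cis; congr (_ * _).
    by rewrite /= /real_complex_def oppr0.
  by rewrite mulr_sumr; apply: eq_bigr => P _; rewrite mulrCA.
move: E => /(congr1 (@complex.Re R)) /= ->.
apply: (@le_trans _ _ (\sum_(p < N) (\sum_P W P) ^+ 2)).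
  by rewrite sumr_const card_ord mulr_natl.
apply: ler_sum => p _; rewrite (bigD1 p) //= subrr.
have -> : charsum W Phi 0 = ((\sum_P W P)%:C)%C.
  by rewrite rmorph_sum; apply: eq_bigr => P _; rewrite mul0r cis0 mulr1.
by rewrite normc_real real_normK ?num_real// lerDl sumr_ge0// => q _;
  apply: sqr_ge0.
Qed.

(** The Fejer kernel is concentrated at 0; a value v away from all Phi P has a
    count that stays bounded as N grows. *)
Lemma fejer_count_far (R : realType) (T : finType) (W Phi : T -> R) N
    (v delta : R) :
  0 < delta -> (forall P, 0 <= W P) ->
  (forall P, 0 < W P -> delta <= `|Phi P - v| <= 1) ->
  fejer_count W Phi N v <= (\sum_P W P) * (16 / delta ^+ 2).
Proof.
move=> d0 W0 far; rewrite mulr_suml; apply: ler_sum => P _.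
have := W0 P; rewrite le_eqVlt => /orP[/eqP <-|WP]; first by rewrite !mul0r.
rewrite ler_pM2l//; have /andP[f1 f2] := far _ WP.
rewrite ler_pdivlMr ?exprn_gt0// mulrC.
apply: le_trans (sqr_normc_dirichlet_le N f2); rewrite ler_wpM2r ?sqr_ge0//.
by rewrite -[leRHS]real_normK ?num_real// ler_sqr ?nnegrE// ltW.
Qed.

(** * Intervals of values, uniformly in the scale *)

Lemma exprn_small (R : realType) (x e : R) : 0 <= x < 1 -> 0 < e ->
  exists l, x ^+ l <= e.
Proof.
move=> /andP[x0 x1] e0.
have := @cvg_expr R x; rewrite ger0_norm// => /(_ x1).
move=> /cvgrPdist_le /(_ e e0) [l _ /(_ l (leqnn l))] /=.
by rewrite sub0r normrN ger0_norm ?exprn_ge0// => ?; exists l.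
Qed.

(** A modulus of continuity that is uniform over all scales n. On the l-th
    dyadic block the sum is at most K (2 th)^l times the minimum of 2 and
    2^(l+1) eta. The first alternative makes the tail converge, and the second
    one makes the finitely many remaining blocks small with eta. *)
Lemma dyadic_modulus (R : realType) (K th eps : R) :
  0 <= K -> 0 <= th -> 2 * th < 1 -> 0 < eps ->
  exists2 eta : R, 0 < eta <= 1 / 2 & forall n (a : nat -> R),
    (forall r, 0 <= a r) ->
    (forall l r, (l < n)%N -> (2 ^ l <= r < 2 ^ l.+1)%N ->
      a r <= K * th ^+ l) ->
    \sum_(r < 2 ^ n) a r * Num.min 2 (r%:R * eta) <= eps.
Proof.
move=> K0 th0 th1 e0.
(* A ratio strictly between tau and 1 leaves room to extract the factor del. *)
pose tau := 2 * th; pose sg := (1 + tau) / 2.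
have [tau0 tau1] : 0 <= tau /\ tau < 1 by rewrite /tau; lra.
have [sg0 sg1 tausg] : [/\ 0 < sg, sg < 1 & tau < sg] by rewrite /sg; split;
  lra.
pose del := eps * (1 - sg) / (K + 1).
have del0 : 0 < del by rewrite /del divr_gt0 ?mulr_gt0//; lra.
have [l0 Hl0] : exists l, (tau / sg) ^+ l <= del / 2.
  apply: exprn_small; last by rewrite divr_gt0.
  by rewrite divr_ge0 ?(ltW sg0)//= ltr_pdivrMr// mul1r.
pose eta := Num.min (1 / 2) (del / 2 ^+ l0).
have eta0 : 0 < eta by rewrite lt_min divr_gt0//= divr_gt0// exprn_gt0.
have eta_le : eta <= del / 2 ^+ l0 by rewrite ge_min lexx orbT.
exists eta; first by rewrite eta0 /= ge_min lexx.
have key l : tau ^+ l * Num.min 2 (2 ^+ l.+1 * eta) <= del * sg ^+ l.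
  have [ll|ll] := ltnP l l0.
    apply: (@le_trans _ _ (sg ^+ l * del)); last by rewrite mulrC.
    apply: ler_pM; rewrite ?exprn_ge0//.
    - by rewrite le_min ler0n mulr_ge0 ?exprn_ge0// ltW.
    - by apply: lerXn2r; rewrite ?nnegrE ?(ltW sg0) ?(ltW tausg).
    - rewrite ge_min; apply/orP; right.
      apply: (@le_trans _ _ (2 ^+ l0 * eta)).
        by rewrite ler_wpM2r ?(ltW eta0)// ler_weXn2l// ler1n.
      by rewrite mulrC -ler_pdivlMr ?exprn_gt0.
  apply: (@le_trans _ _ (tau ^+ l * 2)).
    by rewrite ler_wpM2l ?exprn_ge0// ge_min lexx.
  have -> : tau ^+ l = (tau / sg) ^+ l * sg ^+ l.
    by rewrite -exprMn divfK// gt_eqF.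
  rewrite mulrAC ler_wpM2r ?exprn_ge0 ?(ltW sg0)//.
  rewrite -ler_pdivlMr//; apply: le_trans Hl0.
  apply: ler_wiXn2l => //; first by rewrite divr_ge0 ?(ltW sg0).
  by rewrite ler_pdivrMr// mul1r ltW.
move=> n a a0 ha.
suff H : \sum_(r < 2 ^ n) a r * Num.min 2 (r%:R * eta) <=
    K * del * \sum_(l < n) sg ^+ l.
  apply: (le_trans H).
  have S : \sum_(l < n) sg ^+ l <= (1 - sg)^-1.
    rewrite -[leRHS]mul1r ler_pdivlMr ?subr_gt0// mulrC.
    by rewrite -opprB mulNr -subrX1 opprB gerBl exprn_ge0// ltW.
  apply: (@le_trans _ _ (K * del * (1 - sg)^-1)).
    by rewrite ler_wpM2l// mulr_ge0// ltW.
  have -> : K * del * (1 - sg)^-1 = eps * (K / (K + 1)).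
    by rewrite /del; field; lra.
  rewrite ger_pMr// ler_pdivrMr; lra.
elim: n ha => [|n IH] ha.
  by rewrite !big_ord1 !mul0r big_ord0 mulr0 (min_idPr _)// mulr0.
rewrite big_ord_recr /= mulrDr.
rewrite -(big_mkord xpredT (fun r => a r * Num.min 2 (r%:R * eta))).
rewrite (big_cat_nat (n := (2 ^ n)%N)) ?leq_pexp2l//=; apply: lerD.
  by rewrite big_mkord; apply: IH => l r ln; apply: ha; rewrite ltnS ltnW.
apply: (@le_trans _ _ (\sum_(2 ^ n <= r < 2 ^ n.+1)
   (K * th ^+ n * Num.min 2 (2 ^+ n.+1 * eta)))).
  rewrite big_nat [leRHS]big_nat; apply: ler_sum => r hr.
  apply: ler_pM => //.
  - by rewrite le_min ler0n mulr_ge0// ltW.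
  - exact: ha.
  - rewrite le_min !ge_min lexx /=; apply/orP; right.
    rewrite ler_wpM2r ?(ltW eta0)// -natrX ler_nat.
    by case/andP: hr => _ /ltnW.
rewrite sumr_const_nat expnS mul2n -addnn addnK -[leLHS]mulr_natr natrX.
have -> : K * th ^+ n * Num.min 2 (2 ^+ n.+1 * eta) * 2 ^+ n =
   K * (tau ^+ n * Num.min 2 (2 ^+ n.+1 * eta)) by rewrite /tau exprMn; ring.
by rewrite -mulrA ler_wpM2l.
Qed.

(** The last entry gam P.1.1 stands for the squared distances from x to the
    points that stay fixed; in an exponential sum it contributes a unimodular
    factor that depends on x alone. *)
Definition phase (R : realType) d n (lam : R) (gam : grid d (2 ^ n) -> R)
    (P : grid d (2 ^ n) * grid d (2 ^ n) * grid d (2 ^ n)) : R :=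
  lam * (gdist2 R P.1.1 P.1.2 + gdist2 R P.1.1 P.2) / (2 ^ n)%:R ^+ 2 + gam
    P.1.1.

(** For fixed x the exponential sum factors into a sum over y1 and a sum over
    y2, and the product is bounded by the mean of the two squares. *)
Lemma charsum_phase_le (R : realType) (rho lam : R) d n l j
    (w0 w1 w2 gam : grid d (2 ^ n) -> R) :
  0 <= rho -> 0 < lam <= 1/4 ->
  frostman rho w0 -> frostman rho w1 -> frostman rho w2 ->
  (l <= n)%N -> (2 ^ l <= j < 2 ^ l.+1)%N ->
  normc (charsum (fun P => w0 P.1.1 * w1 P.1.2 * w2 P.2) (phase lam gam) j%:R)
  <= bilinear_const d lam * (2 ^+ d * rho ^+ 2) ^+ l.
Proof.
move=> rho0 lamP f0 f1 f2 ln lj.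
pose S (w : grid d (2 ^ n) -> R) x := \sum_b ((w b)%:C)%C *
     cis (j%:R * (lam * gdist2 R x b / (2 ^ n)%:R ^+ 2)).
have -> : charsum (fun P => w0 P.1.1 * w1 P.1.2 * w2 P.2) (phase lam gam) j%:R =
  \sum_x ((w0 x)%:C)%C * cis (j%:R * gam x) * (S w1 x * S w2 x).
  rewrite /charsum.
  rewrite -(pair_bigA _ (fun xy y2 => ((w0 xy.1 * w1 xy.2 * w2 y2)%:C)%C *
     cis (j%:R * phase lam gam (xy, y2)))) /=.
  rewrite -(pair_bigA _ (fun x y1 => \sum_y2 ((w0 x * w1 y1 * w2 y2)%:C)%C *
     cis (j%:R * phase lam gam ((x, y1), y2)))) /=.
  apply: eq_bigr => x _; rewrite [X in _ = _ * X]mulr_suml mulr_sumr.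
  apply: eq_bigr => y1 _; rewrite [X in _ = _ * X]mulr_sumr mulr_sumr.
  apply: eq_bigr => y2 _; rewrite /phase /=.
  have -> : cis (j%:R * (lam * (gdist2 R x y1 + gdist2 R x y2) / (2 ^ n)%:R ^+
    2 + gam x))
    = cis (j%:R * gam x) * (cis (j%:R * (lam * gdist2 R x y1 / (2 ^ n)%:R ^+
      2)) *
      cis (j%:R * (lam * gdist2 R x y2 / (2 ^ n)%:R ^+ 2))).
    by rewrite -!cisD; congr cis; ring.
  by rewrite !rmorphM /=; ring.
apply: le_trans (normc_sum _ _ _) _.
apply: (@le_trans _ _ (\sum_x (w0 x * normc (S w1 x) ^+ 2 + w0 x * normc (S w2
  x) ^+ 2) / 2)).
  apply: ler_sum => x _.
  rewrite !normcM normc_cis mulr1 normc_real ger0_norm ?(f0.1)//.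
  rewrite -mulrDr -mulrA ler_wpM2l ?(f0.1)//.
  by have := sqr_ge0 (normc (S w1 x) - normc (S w2 x)); lra.
rewrite -mulr_suml big_split /=.
have := bilinear_estimate rho0 lamP f0 f1 ln lj.
have := bilinear_estimate rho0 lamP f0 f2 ln lj.
by rewrite -/(S w1) -/(S w2); lra.
Qed.

(** The condition 2^(d+1) rho^2 < 1, that is 2 s > d + 1, makes the Fourier
    coefficients of the distribution of values summable, uniformly in the
    scale. Some attained value has a count at least proportional to N; by
    uniform continuity the same holds on an interval around it whose length
    does not depend on the scale; and every point with such a count must be
    close to an attained value. *)
Lemma discrete_interval (R : realType) d (rho lam c : R) :
  0 <= rho -> 2 ^+ d.+1 * rho ^+ 2 < 1 -> 0 < lam <= 1/4 -> 0 < c ->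
  exists2 eta : R, 0 < eta & forall delta, 0 < delta ->
  exists n0, forall n, (n0 <= n)%N ->
  forall w0 w1 w2 gam : grid d (2 ^ n) -> R,
  frostman rho w0 -> frostman rho w1 -> frostman rho w2 ->
  c <= \sum_a w0 a -> c <= \sum_a w1 a -> c <= \sum_a w2 a ->
  let W P := w0 P.1.1 * w1 P.1.2 * w2 P.2 in
  (forall P, 0 < W P -> 0 <= phase lam gam P <= 1/2) ->
  exists2 P, 0 < W P & forall v, `|v - phase lam gam P| <= eta ->
    exists2 P', 0 < W P' & `|phase lam gam P' - v| < delta.
Proof.
move=> rho0 rho1 lamP c0.
have [lam0 lam4] : 0 < lam /\ lam <= 1/4 by apply/andP.
have th0 : 0 <= 2 ^+ d * rho ^+ 2 by rewrite mulr_ge0 ?exprn_ge0.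
have th1 : 2 * (2 ^+ d * rho ^+ 2) < 1 by rewrite mulrA -exprS.
have e0 : 0 < c ^+ 3 / 4 by rewrite divr_gt0 ?exprn_gt0.
have [eta /andP[eta0 eta1] mod] := dyadic_modulus (bilinear_const_ge0 d lam)
  th0 th1 e0.
exists eta => // delta delta0.
pose n0 := (Num.truncn (64 / (delta ^+ 2 * c ^+ 3))).+1.
exists n0 => n n0n w0 w1 w2 gam f0 f1 f2 c0' c1' c2' W rng.
set N := (2 ^ n)%N; set Phi := phase lam gam in rng *.
have N0 : 0 < N%:R :> R by rewrite ltr0n expn_gt0.
have NB : 64 / (delta ^+ 2 * c ^+ 3) < N%:R.
  apply: (@lt_le_trans _ _ n0%:R); first by rewrite truncnS_gt.
  by rewrite ler_nat (leq_trans n0n)// ltnW// ltn_expl.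
have W0 P : 0 <= W P by rewrite !mulr_ge0 ?(f0.1) ?(f1.1) ?(f2.1).
set m := \sum_P W P.
have mE : m = (\sum_a w0 a) * (\sum_a w1 a) * (\sum_a w2 a).
  rewrite /m /W -(pair_bigA _ (fun xy y2 => w0 xy.1 * w1 xy.2 * w2 y2)) /=.
  rewrite -(pair_bigA _ (fun x y1 => \sum_y2 w0 x * w1 y1 * w2 y2)) /=.
  under eq_bigr => x _.
    under eq_bigr => y1 _ do rewrite -mulr_sumr.
    rewrite -mulr_suml -mulr_sumr; over.
  by rewrite -!mulr_suml.
have mge : c ^+ 3 <= m.
  rewrite mE exprSr expr2; do 2!(apply: ler_pM => //;
    rewrite ?mulr_ge0 ?(ltW c0)//).
have mle : m <= 1.
  have h0 := frostman_mass f0; have h1 := frostman_mass f1;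
    have h2 := frostman_mass f2.
  have s0 : 0 <= \sum_a w0 a by apply: le_trans c0'; apply: ltW.
  have s1 : 0 <= \sum_a w1 a by apply: le_trans c1'; apply: ltW.
  have s2 : 0 <= \sum_a w2 a by apply: le_trans c2'; apply: ltW.
  by rewrite mE !mulr_ile1// mulr_ge0.
have c3 : 0 < c ^+ 3 by rewrite exprn_gt0.
have m0 : 0 < m by apply: lt_le_trans mge.
have diff u v : `|u - v| <= eta ->
    `|fejer_count W Phi N u - fejer_count W Phi N v| <= N%:R * (m / 2).
  move=> /(fejer_count_diff W Phi N)/le_trans; apply.
  rewrite ler_wpM2l ?(ltW N0)//.
  have := mod n (fun r => normc (charsum W Phi r%:R)) (fun r => normc_ge0 _).
  have H l r : (l < n)%N -> (2 ^ l <= r < 2 ^ l.+1)%N ->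
     normc (charsum W Phi r%:R) <= bilinear_const d lam * (2 ^+ d * rho ^+ 2)
       ^+ l.
    by move=> /ltnW ln lr; apply: charsum_phase_le.
  by move=> /(_ H); rewrite -/N; lra.
(* The weighted mean of the count is at least N m. Asking for 3/4 of it makes
   the comparison of means strict, and 1/4 remains after moving by eta. *)
have [P WP FP] : exists2 P,
  0 < W P & 3 / 4 * N%:R * m <= fejer_count W Phi N (Phi P).
  apply: contrapT => /forall2NP nP.
  have := fejer_count_mean W Phi N; rewrite -/m leNgt => /negP; apply.
  apply: (@le_lt_trans _ _ (\sum_P W P * (3 / 4 * N%:R * m))).
    apply: ler_sum => P _; have := W0 P; rewrite le_eqVlt => /orP[/eqP<-|WP].
      by rewrite !mul0r.
    rewrite ler_pM2l//; have [//|] := nP P.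
    by move=> /negP; rewrite -ltNge => /ltW.
  rewrite -mulr_suml -/m; have : 0 < N%:R * m ^+ 2 by rewrite mulr_gt0
    ?exprn_gt0.
  rewrite expr2; lra.
exists P => // v vP; apply: contrapT => /forall2NP nP.
have far P' : 0 < W P' -> delta <= `|Phi P' - v| <= 1.
  move=> WP'; have [//|/negP] := nP P'; rewrite -leNgt => -> /=.
  have h1 := rng _ WP; have h2 := rng _ WP'.
  by move: vP; rewrite -/Phi ler_norml ler_norml; lra.
have h1 := fejer_count_far N delta0 W0 far.
have h2 := diff _ _ vP; rewrite ler_norml in h2.
have h3 : N%:R * m / 4 <= m * (16 / delta ^+ 2) by rewrite -/m in h1; lra.
have h4 : N%:R <= 64 / delta ^+ 2.
  by rewrite -(ler_pM2l m0); lra.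
have : 64 / delta ^+ 2 <= 64 / (delta ^+ 2 * c ^+ 3).
  rewrite ler_wpM2l// lef_pV2 ?posrE ?mulr_gt0 ?exprn_gt0//.
  by rewrite ger_pMr ?exprn_gt0//; lra.
by lra.
Qed.

(** * Discrete Frostman lemma *)

Definition class_mass (R : realType) (T : finType) (e : nat -> rel T)
    (w : T -> R) k a : R := \sum_(b | e k a b) w b.

(** Levels are treated from the finest to the coarsest, and each class that is
    too heavy is scaled down to its exact capacity. Scaling down never violates
    a finer constraint, and afterwards every point of A lies in a class that is
    filled to capacity: the one of the last scaling that affected the point, or
    the point itself if there was none.
    The classes of e k play the role of the cubes of side 2^k grid steps. *)
Lemma greedy_weights (R : realType) (T : finType) (e : nat -> rel T)
    (kappa : nat -> R) (A : {set T}) :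
  (forall a b, e 0%N a b = (a == b)) ->
  (forall k, equivalence_rel (e k)) ->
  (forall k a b, e k a b -> e k.+1 a b) ->
  (forall k, 0 < kappa k) ->
  forall n, exists w : T -> R, [/\ forall a, 0 <= w a,
    forall a, a \notin A -> w a = 0,
    forall k a, (k <= n)%N -> class_mass e w k a <= kappa k &
    forall a, a \in A -> exists2 k, (k <= n)%N & class_mass e w k a = kappa k].
Proof.
move=> e0 eqv eS kap0.
have e_le k k' a b : (k <= k')%N -> e k a b -> e k' a b.
  by move=> /subnK <-; elim: (k' - k)%N => [//|j IH] /IH; rewrite addSn;
    apply: eS.
elim=> [|n [w [w0 wA wk sat]]].
  exists (fun a => kappa 0%N *+ (a \in A)).
  have E a : class_mass e (fun a => kappa 0%N *+ (a \in A)) 0 a = kappa 0%N *+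
    (a \in A).
    by rewrite /class_mass (eq_bigl (pred1 a)) ?big_pred1_eq// => b;
      rewrite e0 eq_sym.
  split.
  - by move=> a; rewrite mulrn_wge0// ltW.
  - by move=> a /negbTE ->.
  - move=> k a; rewrite leqn0 => /eqP ->; rewrite E.
    by case: (a \in A); rewrite ?mulr1n// ltW.
  - by move=> a aA; exists 0%N => //; rewrite E aA.
pose M a := class_mass e w n.+1 a.
(* The factor s is constant on the classes of every level up to n + 1, so that
   it multiplies their masses. *)
pose s a := if M a <= kappa n.+1 then 1 else kappa n.+1 / M a.
have M_cst a b : e n.+1 a b -> M a = M b.
  move=> ab; apply: eq_bigl => c.
  by have [_ ->] := eqv n.+1 a b c.
have sE a b k : (k <= n.+1)%N -> e k a b -> s b = s a.
  by move=> kn /(e_le _ _ _ _ kn) /M_cst; rewrite /s => ->.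
have Mgt a : (M a <= kappa n.+1) = false -> 0 < M a.
  by move/negbT; rewrite -ltNge; apply: lt_trans.
have s01 a : 0 <= s a <= 1.
  rewrite /s; case: ifPn => [_|]; first by rewrite ler01 lexx.
  move=> /negbTE h; rewrite ler_pdivrMr ?Mgt// mul1r; apply/andP; split.
    by rewrite divr_ge0// ltW ?Mgt.
  by apply: ltW; rewrite ltNge h.
have mE k a : (k <= n.+1)%N ->
    class_mass e (fun b => s b * w b) k a = s a * class_mass e w k a.
  move=> kn; rewrite /class_mass mulr_sumr; apply: eq_bigr => b ab.
  by rewrite (sE a b k).
exists (fun b => s b * w b); split.
- by move=> a; rewrite mulr_ge0//; case/andP: (s01 a).
- by move=> a /wA ->; rewrite mulr0.
- move=> k a; rewrite leq_eqVlt => /predU1P[->|]; last first.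
    rewrite ltnS => kn; rewrite mE ?(leq_trans kn)//.
    apply: le_trans (wk k a kn); case/andP: (s01 a) => s0 s1.
    by apply: ler_piMl => //; apply: sumr_ge0.
  rewrite mE// /s -/(M a); case: ifPn => [|/negbTE h]; first by rewrite mul1r.
  by rewrite divfK// gt_eqF// Mgt.
- move=> a aA; case h : (M a <= kappa n.+1); last first.
    by exists n.+1 => //; rewrite mE// /s h -/(M a) divfK// gt_eqF// Mgt.
  have [k kn satk] := sat a aA; exists k; first by rewrite ltnW.
  by rewrite mE ?(leq_trans kn)// /s h mul1r.
Qed.

(** The total mass is large because the maximal saturated classes cover A: they
    are pairwise disjoint, so their capacities add up to at most the total
    mass. Any lower bound on the cost of covers thus bounds the mass below. *)
Lemma saturated_cover (R : realType) (T : finType) (e : nat -> rel T)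
    (kappa : nat -> R) (A : {set T}) (w : T -> R) n :
  (forall k, equivalence_rel (e k)) ->
  (forall k a b, e k a b -> e k.+1 a b) ->
  (forall a, 0 <= w a) ->
  (forall a, a \in A -> exists2 k, (k <= n)%N & class_mass e w k a = kappa k) ->
  exists r : seq (T * nat), [/\ forall p, p \in r -> (p.2 <= n)%N,
    forall a, a \in A -> exists2 p, p \in r & e p.2 p.1 a &
    \sum_(p <- r) kappa p.2 <= \sum_a w a].
Proof.
move=> eqv eS w0 sat.
have e_le k k' a b : (k <= k')%N -> e k a b -> e k' a b.
  by move=> /subnK <-; elim: (k' - k)%N => [//|j IH] /IH; rewrite addSn;
    apply: eS.
have exx k a : e k a a by have [] := eqv k a a a.
have eC k a b c : e k a b -> e k a c = e k b c by have [_] := eqv k a b c.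
have eS' k a b : e k a b -> e k b a by move=> ab; rewrite -(eC _ _ _ a ab).
pose maxsat a m := a \in A -> [/\ (m <= n)%N, class_mass e w m a = kappa m &
  forall k, (k <= n)%N -> class_mass e w k a = kappa k -> (k <= m)%N].
have [m mP] : {m : T -> nat & forall a, maxsat a (m a)}.
  apply: (@boolp.choice _ _ maxsat) => a; rewrite /maxsat;
    case: (boolP (a \in A)) => [aA|_]; last by exists 0%N.
  have /sat [k0 k0n satk] := aA.
  pose P (k : nat) := (k <= n)%N && (class_mass e w k a == kappa k).
  have exP : exists k, P k by exists k0; rewrite /P k0n satk eqxx.
  have ubP k : P k -> (k <= n)%N by case/andP.
  case: (ex_maxnP exP ubP) => k /andP[kn /eqP E] kmax.
  by exists k => _; split=> // k' k'n E'; apply: kmax; rewrite /P k'n E' eqxx.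
pose cls a := [set b | e (m a) a b]%SET.
have cls_eq a a' b : a \in A -> a' \in A -> (m a <= m a')%N ->
    b \in cls a -> b \in cls a' -> cls a = cls a'.
  move=> aA a'A mm; rewrite !inE => ab a'b.
  have [_ _ maxa] := mP a aA; have [ma' sata' _] := mP a' a'A.
  have aa' : e (m a') a a'.
    by rewrite (eC _ _ _ a' (e_le _ _ _ _ mm ab)) eS'.
  have E : m a = m a'.
    apply/eqP; rewrite eqn_leq mm /=; apply: maxa => //.
    by rewrite -sata'; apply: eq_bigl => c; apply: eC.
  by apply/finset.setP => c; rewrite !inE E; apply: eC.
pose CC := (cls @: A)%SET.
have triv : finset.trivIset CC.
  apply/finset.trivIsetP => _ _ /imsetP[a aA ->] /imsetP[a' a'A ->] ne.
  rewrite -finset.setI_eq0; apply/negPn/negP => /finset.set0Pn [b];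
    rewrite inE => /andP[h h'].
  move: ne => /eqP; apply; case: (leqP (m a) (m a')) => [mm|/ltnW mm].
    exact: (cls_eq _ _ b).
  by apply/esym; apply: (cls_eq _ _ b).
have [->|/finset.set0Pn [a0 _]] := eqVneq A finset.set0.
  exists [::]; split=> // [a|]; first by rewrite inE.
  by rewrite big_nil sumr_ge0.
pose label C (p : T * nat) := C \in CC ->
  [/\ p.1 \in A, C = cls p.1 & p.2 = m p.1].
have [f fP] : {f : {set T} -> T * nat & forall C, label C (f C)}.
  apply: (@boolp.choice _ _ label) => C; rewrite /label.
  case: (boolP (C \in CC)) => [/imsetP[a aA ->]|_]; last by exists (a0, 0%N).
  by exists (a, m a).
exists [seq f C | C <- enum CC]; split.
- move=> p /mapP [C]; rewrite mem_enum => CCC ->.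
  by have [h _ ->] := fP C CCC; have [] := mP _ h.
- move=> a aA; exists (f (cls a)).
    by rewrite map_f// mem_enum imset_f.
  have ha : a \in cls a by rewrite inE exx.
  have [h E ->] := fP (cls a) (imset_f _ aA).
  by rewrite E inE in ha.
rewrite big_map big_enum /=.
apply: (@le_trans _ _ (\sum_(C in CC) \sum_(b in C) w b)).
  apply: ler_sum => C CCC; have [h E ->] := fP C CCC.
  have [_ <- _] := mP _ h; rewrite /class_mass le_eqVlt; apply/orP; left.
  by apply/eqP; apply: eq_bigl => b; rewrite [in RHS]E inE.
rewrite -finset.big_trivIset//= [leRHS](bigID (mem (finset.cover CC)))/= lerDl
  sumr_ge0//.
Qed.

Lemma grid_frostman (R : realType) (rho : R) d n (A : {set grid d (2 ^ n)}) :
  0 < rho -> exists w : grid d (2 ^ n) -> R, [/\ frostman rho w,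
    forall a, a \notin A -> w a = 0 &
    exists r : seq (grid d (2 ^ n) * nat), [/\ forall p, p \in r ->
      (p.2 <= n)%N,
      forall a, a \in A -> exists2 p, p \in r &
        forall i, (p.1 i %/ 2 ^ p.2 = a i %/ 2 ^ p.2)%N &
    \sum_(p <- r) rho ^+ (n - p.2) <= \sum_a w a]].
Proof.
move=> rho0.
pose e k (a b : grid d (2 ^ n)) := [forall i,
  (a i %/ 2 ^ k)%N == (b i %/ 2 ^ k)%N].
have e0 a b : e 0%N a b = (a == b).
  apply/forallP/eqP => [H|-> //]; apply/ffunP => i; apply/val_inj => /=.
  by have := H i; rewrite expn0 !divn1 => /eqP.
have eqv k : equivalence_rel (e k).
  move=> a b c; split; first by apply/forallP.
  move=> /forallP ab; apply/forallP/forallP => H i.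
    by rewrite -(eqP (ab i)).
  by rewrite (eqP (ab i)).
have eS k a b : e k a b -> e k.+1 a b.
  move=> /forallP H; apply/forallP => i.
  by rewrite expnSr !divnMA (eqP (H i)).
have kap0 k : 0 < rho ^+ (n - k) by rewrite exprn_gt0.
have [w [w0 wA wk sat]] := greedy_weights A e0 eqv eS kap0 n.
exists w; split=> //.
  split=> // l c ln.
  case: (pickP (fun a : grid d (2 ^ n) => [forall i,
    (a i %/ 2 ^ (n - l))%N == c i])) => [a /forallP ac|none].
    have := wk (n - l)%N a (leq_subr _ _); rewrite subKn//; apply: le_trans.
    rewrite le_eqVlt; apply/orP; left; apply/eqP; apply: eq_bigl => b.
    by apply/eq_forallb => i; rewrite (eqP (ac i)) eq_sym.
  by rewrite big_pred0// exprn_ge0// ltW.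
have [r [r1 r2 r3]] := saturated_cover eqv eS w0 sat.
exists r; split=> // a /r2 [p pr /forallP H]; exists p => // i.
exact/eqP.
Qed.

(** * Sets of positive Hausdorff content *)

Definition inbox (R : realType) (d : nat) (y : 'rV[R]_d)
    (r : R) : set 'rV[R]_d :=
  [set x | forall i, `|x ord0 i - y ord0 i| <= r].

Definition coverable (R : realType) (d : nat) (s : R) (A : set 'rV[R]_d)
    (c : R) :=
  exists cs : seq ('rV[R]_d * R), [/\ forall p, p \in cs -> 0 < p.2,
    forall x, A x -> exists2 p, p \in cs & inbox p.1 p.2 x &
    \sum_(p <- cs) p.2 `^ s <= c].

(** Vanishing s-dimensional Hausdorff content, with finite covers by boxes; for
    compact sets and s > 0 this means that the s-dimensional Hausdorff measure
    vanishes. Working with the content removes the restriction on diameters. *)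
Definition light (R : realType) (d : nat) (s : R) (A : set 'rV[R]_d) :=
  forall c, 0 < c -> coverable s A c.

Lemma coverableU (R : realType) (d : nat) (s : R) (A B : set 'rV[R]_d) a b :
  coverable s A a -> coverable s B b -> coverable s (A `|` B) (a + b).
Proof.
move=> [ca [pa covA sa]] [cb [pb covB sb]]; exists (ca ++ cb); split.
- by move=> p; rewrite mem_cat => /orP[/pa|/pb].
- move=> x [/covA|/covB] [p pc xp]; exists p => //; rewrite mem_cat pc ?orbT//.
- by rewrite big_cat lerD.
Qed.

Lemma coverableS (R : realType) (d : nat) (s : R) (A B : set 'rV[R]_d) a :
  A `<=` B -> coverable s B a -> coverable s A a.
Proof. by move=> AB [cs [h1 h2 h3]]; exists cs; split=> // x /AB /h2. Qed.

Lemma coverable_le (R : realType) (d : nat) (s : R) (A : set 'rV[R]_d) a b :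
  a <= b -> coverable s A a -> coverable s A b.
Proof. by move=> ab [cs [h1 h2 h3]]; exists cs; split=> //;
  apply: le_trans ab. Qed.

Lemma coverable_big (R : realType) (d : nat) (s : R) (T : eqType) (L : seq T)
    (A : T -> set 'rV[R]_d) (b : T -> R) :
  (forall t, t \in L -> coverable s (A t) (b t)) ->
  coverable s [set x | exists2 t, t \in L & A t x] (\sum_(t <- L) b t).
Proof.
elim: L => [|t L IH] H.
  by exists [::]; split=> //; [move=> x [t]|rewrite !big_nil].
rewrite big_cons; apply: coverableS (coverableU (H t _) (IH _)).
- move=> x [u]; rewrite inE => /predU1P[->|uL] Ax; [by left|by right; exists u].
- by rewrite inE eqxx.
- by move=> u uL; apply: H; rewrite inE uL orbT.
Qed.

Lemma ediam_inbox (R : realType) (d : nat) (y : 'rV[R]_d) (r : R) : 0 <= r ->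
  (ediam (inbox y r) <= (2 * (d%:R + 1) * r)%:E)%E.
Proof.
move=> r0; have D0 : 0 <= 2 * (d%:R + 1) * r by rewrite !mulr_ge0// addr_ge0.
rewrite /ediam ge_max lee_fin D0 /=; apply: ge_ereal_sup => _ [x xy] [z zy] <-.
rewrite lee_fin /enorm -[leRHS]ger0_norm// -sqrtr_sqr ler_sqrt ?sqr_ge0//.
apply: (@le_trans _ _ (\sum_(i < d) (2 * r) ^+ 2)).
  apply: ler_sum => i _; rewrite !mxE -[leLHS]real_normK ?num_real//.
  rewrite ler_sqr ?nnegrE ?mulr_ge0//.
  by have := xy i; have := zy i; rewrite !ler_norml => /andP[? ?] /andP[? ?];
    lra.
rewrite sumr_const card_ord -mulr_natl.
have : 0 <= (d%:R ^+ 2 + d%:R + 1) * (4 * r ^+ 2) :> R.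
  by rewrite mulr_ge0 ?addr_ge0 ?sqr_ge0// mulr_ge0 ?sqr_ge0.
by lra.
Qed.

Lemma hausdorff_gauge_ge0 (R : realType) (d : nat) (s : R) (A : set 'rV[R]_d) :
  (0 <= hausdorff_gauge s A)%E.
Proof. by rewrite /hausdorff_gauge; case: ifP => // _; apply: poweR_ge0. Qed.

Lemma ediam_ge0 (R : realType) (d : nat) (A : set 'rV[R]_d) : (0 <= ediam A)%E.
Proof. by rewrite /ediam le_max lexx. Qed.

Lemma premeasure_ge0 (R : realType) (d : nat) (s del : R) (A : set 'rV[R]_d) :
  (0 <= hausdorff_premeasure s del A)%E.
Proof.
apply: le_ereal_inf_tmp => _ [U _ <-].
by apply: nneseries_ge0 => *; apply: hausdorff_gauge_ge0.
Qed.

(** A cover of small total cost consists of small boxes, as each radius is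
    controlled by the total. Hence covers of small cost have small diameters
    automatically. *)
Lemma light_premeasure (R : realType) (d : nat) (s del : R) (A : set 'rV[R]_d) :
  0 < s -> 0 < del -> light s A -> (hausdorff_premeasure s del A <= 0)%E.
Proof.
move=> s0 del0 lA; apply/lee_addgt0Pr => e e0; rewrite add0e.
(* D times the radius bounds the Euclidean diameter of a box. *)
pose D := 2 * (d%:R + 1) : R.
have D0 : 0 < D by rewrite mulr_gt0// ltr_wpDl.
have Ds0 : 0 < D `^ s by apply: powR_gt0.
pose c := Num.min (e / D `^ s) ((del / D) `^ s).
have c0 : 0 < c by rewrite lt_min divr_gt0//= powR_gt0// divr_gt0.
have [cs [pos cov sum]] := lA c c0.
have small p : p \in cs -> D * p.2 <= del.
  move=> pcs; rewrite mulrC -ler_pdivlMr//.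
  have h : p.2 `^ s <= (del / D) `^ s.
    apply: (@le_trans _ _ c); last by rewrite ge_min lexx orbT.
    apply: le_trans sum; rewrite (big_rem p)//= lerDl sumr_ge0// => q _.
    exact: powR_ge0.
  rewrite leNgt; apply/negP => /(gt0_ltr_powR s0).
  rewrite !nnegrE (ltW (pos _ pcs)) divr_ge0 ?(ltW del0) ?(ltW D0)//.
  by move=> /(_ isT isT); rewrite ltNge h.
pose U i := if (i < size cs)%N then
  inbox (nth (0, 0) cs i).1 (nth (0, 0) cs i).2 else set0.
apply: ge_ereal_inf; exists (\sum_(0 <= i <oo) hausdorff_gauge s (U i))%E.
  exists U => //; split.
    move=> x /cov [p pcs xp]; exists (index p cs) => //.
    by rewrite /U index_mem pcs nth_index.
  move=> i; rewrite /U; case: ifPn => [ics|_]; last first.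
    rewrite /ediam ge_max lee_fin (ltW del0) /=; apply: ge_ereal_sup.
    by move=> _ [x []].
  have pi := mem_nth (0, 0) ics.
  apply: le_trans (ediam_inbox _ (ltW (pos _ pi))) _.
  by rewrite lee_fin small.
apply: lime_le; first by apply: is_cvg_nneseries => *;
  apply: hausdorff_gauge_ge0.
exists (size cs) => // n /= csn.
rewrite (big_cat_nat (n := size cs))//= [X in (_ + X)%E]big_nat_cond.
rewrite [X in (_ + X)%E]big1 ?adde0; last first.
  move=> i /andP[/andP[ci _] _]; rewrite /U ltnNge ci /= /hausdorff_gauge.
  by case: asboolP.
apply: (@le_trans _ _ (\sum_(0 <= i < size cs) ((D `^ s) * (nth (0,
  0) cs i).2 `^ s)%:E)%E).
  rewrite big_nat [leRHS]big_nat; apply: lee_sum => i /= ics.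
  have pi := mem_nth (0, 0) ics.
  have p0 := ltW (pos _ pi).
  rewrite /hausdorff_gauge; case: asboolP => _.
    by rewrite lee_fin mulr_ge0 ?powR_ge0.
  rewrite -powRM ?(ltW D0)// -poweR_EFin; apply: gt0_ler_poweR;
    first exact: ltW.
  - by rewrite in_itv /= ediam_ge0 leey.
  - by rewrite in_itv /= leey lee_fin mulr_ge0// ltW.
  - by rewrite /U ics; apply: ediam_inbox.
rewrite sumEFin lee_fin -mulr_sumr mulrC -ler_pdivlMr//.
apply: (@le_trans _ _ c); last by rewrite ge_min lexx.
by rewrite (big_nth (0, 0)) in sum.
Qed.

Lemma not_light (R : realType) (d : nat) (s : R) (A : set 'rV[R]_d) :
  0 < s -> (s%:E < hausdorff_dim A)%E -> ~ light s A.
Proof.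
move=> s0 sd lA; move: sd; rewrite ltNge => /negP; apply.
apply: ereal_inf_lbound; exists s => //; split; first exact: ltW.
apply/eqP; rewrite eq_le; apply/andP; split.
  by apply: ge_ereal_sup => _ [del del0 <-]; apply: light_premeasure.
apply: (@le_trans _ _ (hausdorff_premeasure s 1 A));
  first exact: premeasure_ge0.
by apply: ereal_sup_ubound; exists 1 => //=; apply: ltr01.
Qed.

(** * Heavy points and Frostman weights of a set *)

Lemma powR_small (R : realType) (s c : R) : 0 < s -> 0 < c ->
  exists2 r : R, 0 < r & r `^ s <= c.
Proof.
move=> s0 c0; exists (c `^ s^-1); first exact: powR_gt0.
by rewrite -powRrM mulVf ?gt_eqF// powRr1// ltW.
Qed.

(** If every point of E outside F had a light neighbourhood, compactness would
    cover E by finitely many of these together with small boxes around the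
    points of F, at arbitrarily small cost because s > 0. *)
Lemma heavy_point (R : realType) (d : nat) (s : R) (E : set 'rV[R]_d)
    (F : seq 'rV[R]_d) :
  0 < s -> compact E -> ~ light s E ->
  exists p, [/\ E p, p \notin F & forall r, 0 < r ->
    ~ light s (E `&` inbox p r)].
Proof.
move=> s0 cE nl; apply: contrapT => nex; apply: nl => c c0.
have [r0 r00 hr0] : exists2 r : R,
  0 < r & r `^ s <= c / (2 * ((size F)%:R + 1)).
  by apply: powR_small => //; rewrite divr_gt0// mulr_gt0// ltr_wpDl.
pose good p (r : R) := 0 < r /\ (E p -> if p \in F then r = r0
   else light s (E `&` inbox p r)).
have [f fP] : {f : 'rV[R]_d -> R & forall p, good p (f p)}.
  apply: (@boolp.choice _ _ good) => p; rewrite /good.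
  case: (boolP (p \in F)) => pF; first by exists r0.
  have [Ep|nEp] := pselect (E p); last by exists 1.
  apply: contrapT => nr; apply: nex; exists p; split=> // r r1 lr.
  by apply: nr; exists r.
have := cE; rewrite compact_cover => /(_ 'rV[R]_d E (fun p => (ball p (f p))°)).
case.
- by move=> p _; apply: open_interior.
- move=> x Ex; exists x => //; rewrite /interior.
  by apply: nbhsx_ballx; case: (fP x).
move=> D DE cov.
pose L := enum_fset D.
pose eps := c / (2 * ((size L)%:R + 1)).
have eps0 : 0 < eps by rewrite divr_gt0// mulr_gt0// ltr_wpDl.
pose b p := if p \in F then r0 `^ s else eps.
have cb p : p \in L -> coverable s (E `&` inbox p (f p)) (b p).
  move=> pL; have Ep : E p by apply: set_mem (DE p pL).
  have [fp0 /(_ Ep)] := fP p; rewrite /b; case: ifPn => pF.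
    move=> ->; exists [:: (p, r0)]; split.
    - by move=> q; rewrite inE => /eqP ->.
    - by move=> x [_ xp]; exists (p, r0); rewrite ?inE.
    - by rewrite big_seq1.
  by apply.
apply: coverableS (coverable_le _ (coverable_big cb)).
  move=> x Ex; have [p pD xp] := cov x Ex; exists p => //; split=> // i.
  have [_ /(_ ord0 i)] := interior_subset xp; rewrite /ball /= distrC.
  exact: ltW.
rewrite (bigID (mem F)) /=.
have -> : c = c / 2 + c / 2 by lra.
apply: lerD.
  apply: (@le_trans _ _ (\sum_(p <- L | p \in F) r0 `^ s)).
    by apply: ler_sum => p pF; rewrite /b pF.
  rewrite big_const_seq iter_addr_0.
  have sz : (count (mem F) L <= size F)%N.
    rewrite -size_filter; apply: uniq_leq_size;
      first by rewrite filter_uniq// fset_uniq.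
    by move=> p; rewrite mem_filter => /andP[].
  apply: (@le_trans _ _ (r0 `^ s *+ size F));
    first by rewrite -[leLHS]mulr_natr -[leRHS]mulr_natr ler_wpM2l ?powR_ge0//
      ler_nat.
  rewrite -mulr_natr.
  apply: (@le_trans _ _ (c / (2 * ((size F)%:R + 1)) * (size F)%:R)).
    by rewrite ler_wpM2r.
  have -> : c / (2 * ((size F)%:R + 1)) * (size F)%:R = c / 2 * ((size F)%:R /
    ((size F)%:R + 1)).
    by field; rewrite gt_eqF// ltr_wpDl.
  by rewrite ger_pMr ?divr_gt0// ler_pdivrMr ?ltr_wpDl// mul1r lerDl.
apply: (@le_trans _ _ (\sum_(p <- L | p \notin F) eps)).
  by apply: ler_sum => p pF; rewrite /b (negbTE pF).
rewrite big_const_seq iter_addr_0.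
apply: (@le_trans _ _ (eps *+ size L));
  first by rewrite -[leLHS]mulr_natr -[leRHS]mulr_natr ler_wpM2l ?ler_nat
    ?count_size// ltW.
rewrite -mulr_natr /eps.
have -> : c / (2 * ((size L)%:R + 1)) * (size L)%:R = c / 2 * ((size L)%:R /
  ((size L)%:R + 1)).
  by field; rewrite gt_eqF// ltr_wpDl.
by rewrite ger_pMr ?divr_gt0// ler_pdivrMr ?ltr_wpDl// mul1r lerDl.
Qed.

Lemma heavy_points (R : realType) (d : nat) (s : R) (E : set 'rV[R]_d) m :
  0 < s -> compact E -> ~ light s E ->
  exists ps : seq 'rV[R]_d, [/\ size ps = m, uniq ps &
   forall p, p \in ps -> E p /\ forall r, 0 < r -> ~ light s (E `&` inbox p r)].
Proof.
move=> s0 cE nl; elim: m => [|m [ps [sz un H]]]; first by exists [::].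
have [p [Ep pn hp]] := heavy_point ps s0 cE nl.
exists (p :: ps); split=> /=; [by rewrite sz|by rewrite pn|].
by move=> q; rewrite inE => /predU1P[->|/H].
Qed.

(** The cube [-M, M + 1)^d is cut into 2^n cells in each direction; the side
    2 M + 1 is positive also for M = 0, and half-open cells then suffice. *)
Definition incell (R : realType) (M : R) d n (a : grid d (2 ^ n))
    (x : 'rV[R]_d) :=
  forall i, (a i)%:R <= (x ord0 i + M) / (2 * M + 1) * (2 ^ n)%:R
              < (a i)%:R + 1.

Lemma incell_exists (R : realType) (M : R) d n (x : 'rV[R]_d) :
  (forall i, `|x ord0 i| <= M) -> exists a : grid d (2 ^ n), incell M a x.
Proof.
move=> xM; pose u i := (x ord0 i + M) / (2 * M + 1) * (2 ^ n)%:R.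
have N0 : 0 < (2 ^ n)%:R :> R by rewrite ltr0n expn_gt0.
have u01 i : 0 <= u i < (2 ^ n)%:R.
  have := xM i; rewrite ler_norml => /andP[h1 h2].
  have L0 : 0 < 2 * M + 1 by lra.
  rewrite /u mulr_ge0 ?divr_ge0 ?(ltW L0)//=; last by lra.
  by rewrite -[ltRHS]mul1r ltr_pM2r// ltr_pdivrMr// mul1r; lra.
have lt i : (Num.truncn (u i) < 2 ^ n)%N.
  rewrite -(ltr_nat R); have /andP[h1 h2] := u01 i.
  by apply: le_lt_trans h2; case/andP: (truncn_itv h1).
exists [ffun i => Ordinal (lt i)] => i; rewrite ffunE /= natr1.
by apply: truncn_itv; case/andP: (u01 i).
Qed.

Lemma powR_dyadic (R : realType) (s : R) k n : (k <= n)%N ->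
  (2 ^+ k / (2 ^ n)%:R) `^ s = 2 `^ (- s) ^+ (n - k) :> R.
Proof.
move=> kn.
have -> : 2 ^+ k / (2 ^ n)%:R = 2 `^ (- (n - k)%:R) :> R.
  have split_n : 2 ^+ n = 2 ^+ k * 2 ^+ (n - k) :> R by rewrite -exprD subnKC.
  rewrite powRN powR_mulrn// natrX split_n invfM mulrA mulfV ?mul1r//.
by rewrite -(powR_mulrn _ (powR_ge0 2 (- s))) -!powRrM !mulNr mulrC.
Qed.

(** The discrete Frostman lemma for the cells that meet E: a small total mass
    would turn the saturated cubes into a cheap cover of E. *)
Lemma frostman_set (R : realType) (M s : R) d (E : set 'rV[R]_d) :
  0 <= M -> 0 < s -> (forall x, E x -> forall i, `|x ord0 i| <= M) ->
    ~ light s E ->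
  exists2 c, 0 < c & forall n, exists w : grid d (2 ^ n) -> R,
    [/\ frostman (2 `^ (- s)) w, forall a, w a != 0 ->
      exists2 x, E x & incell M a x &
    c <= \sum_a w a].
Proof.
move=> M0 s0 EM nl.
have [c c0 nc] : exists2 c, 0 < c & ~ coverable s E c.
  apply: contrapT => nex; apply: nl => c c0; apply: contrapT => ncov.
  by apply: nex; exists c.
pose L := 2 * M + 1; have L0 : 0 < L by rewrite /L; lra.
exists (c / L `^ s); first by rewrite divr_gt0// powR_gt0.
move=> n; pose A := [set a : grid d (2 ^ n) | `[< exists2 x,
  E x & incell M a x >]]%SET.
have N0 : 0 < (2 ^ n)%:R :> R by rewrite ltr0n expn_gt0.
have rho0 : 0 < 2 `^ (- s) :> R by apply: powR_gt0.
have [w [fw wA [r [rn cov sum]]]] := grid_frostman A rho0.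
exists w; split=> //.
  move=> a /eqP wa; have : a \in A by apply/negPn/negP => /wA.
  by rewrite inE => /asboolP.
rewrite ler_pdivrMr ?powR_gt0// leNgt; apply/negP => lt_c.
apply: nc; pose ctr (a : grid d (2 ^ n)) : 'rV[R]_d :=
  \row_i (L * (a i)%:R / (2 ^ n)%:R - M).
pose rad k : R := L * 2 ^+ k / (2 ^ n)%:R.
have rad0 k : 0 < rad k by rewrite divr_gt0// mulr_gt0// exprn_gt0.
exists [seq (ctr p.1, rad p.2) | p <- r]; split.
- by move=> q /mapP [p _ ->] /=; apply: rad0.
- move=> x Ex; have [a ax] := incell_exists n (EM x Ex).
  have aA : a \in A by rewrite inE; apply/asboolP; exists x.
  have [p pr pa] := cov a aA.
  exists (ctr p.1, rad p.2); first exact: map_f.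
  move=> i /=; rewrite mxE.
  have -> : x ord0 i - (L * (p.1 i)%:R / (2 ^ n)%:R - M) =
     L / (2 ^ n)%:R * ((x ord0 i + M) / L * (2 ^ n)%:R - (p.1 i)%:R).
    by field; rewrite !gt_eqF.
  have -> : rad p.2 = L / (2 ^ n)%:R * 2 ^+ p.2 by rewrite /rad mulrAC.
  rewrite normrM gtr0_norm ?divr_gt0// ler_pM2l ?divr_gt0//.
  have /andP[h1 h2] := ax i; rewrite -/L in h1 h2.
  have P0 : (0 < 2 ^ p.2)%N by rewrite expn_gt0.
  have h3 : (a i + 1 <= p.1 i + 2 ^ p.2)%N.
    by rewrite addn1; apply: same_block_lt.
  have h4 : (p.1 i <= a i + 2 ^ p.2)%N by apply/ltnW/same_block_lt.
  move: h3 h4; rewrite -!(ler_nat R) !natrD natrX => h3 h4.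
  by rewrite ler_norml; lra.
rewrite big_map /=.
apply: (@le_trans _ _ (\sum_(p <- r) (2 `^ (- s)) ^+ (n - p.2) * L `^ s)).
  rewrite big_seq [leRHS]big_seq; apply: ler_sum => p /rn pn.
  rewrite /rad -mulrA powRM ?(ltW L0) ?divr_ge0 ?exprn_ge0//.
  by rewrite powR_dyadic// mulrC.
rewrite -mulr_suml; apply: le_trans (ltW lt_c).
by rewrite ler_wpM2r// powR_ge0.
Qed.

(** * Euclidean and topological preliminaries *)

(** For k at least 4 the threshold is smallest at k = 4, where the comparison
    of 3 d / 4 with (d + 1) / 2 amounts to d >= 2. *)
Lemma dim_threshold_ge (R : realType) (d k : nat) : (2 <= d)%N -> (3 <= k)%N ->
  (d%:R + 1) / 2 <= dim_threshold R d k.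
Proof.
move=> d2 k3; rewrite /dim_threshold; have : 2 <= d%:R :> R by rewrite ler_nat.
case: eqVneq => [_|k_neq]; first by lra.
have k4 : 4 <= k%:R :> R by rewrite ler_nat ltn_neqAle eq_sym k_neq.
move=> dR; rewrite ler_pdivlMr; last by lra.
by nra.
Qed.

Lemma lte_fin_between (R : realType) (a : R) (y : \bar R) :
  (a%:E < y)%E -> exists2 s, a < s & (s%:E < y)%E.
Proof.
case: y => [y| |//]; last by exists (a + 1); rewrite ?ltry// ltrDl.
rewrite lte_fin => ay; exists ((a + y) / 2); first by rewrite midf_lt.
by rewrite lte_fin midf_lt.
Qed.

Lemma inbox_compact (R : realType) d (p : 'rV[R]_d) r : compact (inbox p r).
Proof.
have -> : inbox p r = [set v : 'rV[R]_d | forall i, [set` `[p ord0 i - r,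
  p ord0 i + r]] (v ord0 i)].
  apply/seteqP; split => v H i; have := H i; rewrite /= in_itv /=.
    by rewrite ler_norml; lra.
  by rewrite ler_norml; lra.
exact: (rV_compact (A := fun i => [set` `[p ord0 i - r,
  p ord0 i + r]]) (fun i => @segment_compact R _ _)).
Qed.

Lemma inbox_closed (R : realType) d (p : 'rV[R]_d) r : closed (inbox p r).
Proof. by apply: compact_closed;
  [exact: norm_hausdorff|exact: inbox_compact]. Qed.

Lemma compact_coord_bound (R : realType) d (E : set 'rV[R]_d) : compact E ->
  exists2 M, 0 <= M & forall x, E x -> forall i, `|x ord0 i| <= M.
Proof.
move=> /compact_bounded [M [_ H]].
exists (`|M| + 2) => [|x Ex i]; first by rewrite addr_ge0.
have : ball (0 : 'rV[R]_d) (`|M| + 2) x.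
  rewrite mx_norm_ball /ball_ /= sub0r normrN.
  have := H (`|M| + 1) _ x Ex => h; apply: (@le_lt_trans _ _ (`|M| + 1));
    last by rewrite ltrD2l; lra.
  by apply: h; have := ler_norm M; lra.
by move=> [_ /(_ ord0 i)]; rewrite /ball /= mxE sub0r normrN => /ltW.
Qed.

Lemma separating_radius (R : realType) d (p : 'rV[R]_d) (qs : seq 'rV[R]_d) :
  p \notin qs -> exists2 r, 0 < r & forall q, q \in qs -> ~ inbox p r q.
Proof.
elim: qs => [|q qs IH]; first by exists 1.
rewrite inE negb_or => /andP[pq /IH [r r0 H]].
have [i pqi] : exists i, p ord0 i != q ord0 i.
  apply: contrapT => nex; move/eqP: pq; apply; apply/rowP => i.
  by apply/eqP/negPn/negP => h; apply: nex; exists i.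
have D0 : 0 < `|q ord0 i - p ord0 i| by rewrite normr_gt0 subr_eq0 eq_sym.
exists (Num.min r (`|q ord0 i - p ord0 i| / 2));
  first by rewrite lt_min r0 divr_gt0.
move=> x; rewrite inE => /predU1P[->|xqs] xin.
  have := xin i; rewrite le_min => /andP[_]; lra.
apply: (H x xqs) => j; apply: le_trans (xin j) _; by rewrite ge_min lexx.
Qed.

Definition sqd (R : realType) d (x y : 'rV[R]_d) : R :=
  \sum_i (x ord0 i - y ord0 i) ^+ 2.

Lemma sqd_ge0 (R : realType) d (x y : 'rV[R]_d) : 0 <= sqd x y.
Proof. by apply: sumr_ge0 => i _; apply: sqr_ge0. Qed.

Lemma enorm_concat (R : realType) m d (u v : 'I_m -> 'rV[R]_d) :
  enorm (concat_vec u - concat_vec v) = Num.sqrt (\sum_i sqd (u i) (v i)).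
Proof.
rewrite /enorm; congr Num.sqrt.
rewrite (reindex _ (curry_mxvec_bij m d)) /= /sqd pair_bigA /=.
apply: eq_bigr => -[i j] _; rewrite /= !mxE.
by rewrite !mxvecE !mxE.
Qed.

Lemma continuous_sum (R : realType) (T : topologicalType) (I : Type) (s : seq I)
    (f : I -> T -> R) :
  (forall i, continuous (f i)) -> continuous (fun x => \sum_(i <- s) f i x).
Proof.
move=> cf; elim: s => [|i s IH] x.
  have -> : (fun x => \sum_(i <- [::]) f i x) = cst 0.
    by apply/funext => y; rewrite big_nil.
  exact: cvg_cst.
have -> : (fun x => \sum_(i <- i :: s) f i x) = f i \+ (fun x => \sum_(i <- s)
  f i x).
  by apply/funext => y; rewrite big_cons.
by apply: continuousD; [exact: cf|exact: IH].
Qed.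

Lemma continuous_sqd (R : realType) (T : topologicalType) d
    (f g : T -> 'rV[R]_d) :
  continuous f -> continuous g -> continuous (fun x => sqd (f x) (g x)).
Proof.
move=> cf cg; apply: continuous_sum => i x.
have cc : {for x, continuous (fun x => f x ord0 i - g x ord0 i)}.
  apply: continuousB.
    by apply: (continuous_comp (f := f) (g := fun v : 'rV[R]_d => v ord0 i));
      [exact: cf|exact: coord_continuous].
  by apply: (continuous_comp (f := g) (g := fun v : 'rV[R]_d => v ord0 i));
    [exact: cg|exact: coord_continuous].
have -> : (fun x => (f x ord0 i - g x ord0 i) ^+ 2) =
   (fun x => (f x ord0 i - g x ord0 i)) \* (fun x => (f x ord0 i - g x ord0 i)).
  by apply/funext => y; rewrite expr2.
exact: continuousM.
Qed.

Lemma closed_gap (R : realType) (S : set R) (v : R) : closed S -> ~ S v ->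
  exists2 r, 0 < r & forall s, S s -> r <= `|s - v|.
Proof.
move=> cS nSv; have : nbhs v (~` S) by apply: open_nbhs_nbhs; split=> //;
  exact: closed_openC.
move=> /nbhs_ballP [r /= r0 H]; exists r => // s Ss.
rewrite leNgt; apply/negP => sv; apply: (H s) => //.
by rewrite /ball /= distrC.
Qed.

(** A closed set without interior misses a point in each of the finitely many
    intervals of length eta that cover [0, 1], and it stays at a positive
    distance from each of these points. *)
Lemma uniform_gap (R : realType) (S : set R) (eta : R) : closed S -> 0 < eta ->
  (forall u v, 0 <= u -> u < v -> exists2 t, u < t < v & ~ S t) ->
  exists2 r, 0 < r & forall t, 0 <= t <= 1 -> exists2 v, `|v - t| <= eta &
    forall s, S s -> r <= `|s - v|.
Proof.
move=> cS eta0 dense.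
have step m : exists2 r, 0 < r & forall t, 0 <= t < m%:R * eta ->
    exists2 v, `|v - t| <= eta & forall s, S s -> r <= `|s - v|.
  elim: m => [|m [r r0 H]]; first by exists 1 => // t; rewrite mul0r => ?; lra.
  have m0 : 0 <= m%:R * eta by rewrite mulr_ge0// ltW.
  have [v vI nSv] : exists2 v, m%:R * eta < v < m.+1%:R * eta & ~ S v.
    by apply: dense => //; rewrite ltr_pM2r// ltr_nat.
  have [r' r'0 H'] := closed_gap cS nSv.
  exists (Num.min r r'); first by rewrite lt_min r0.
  move=> t /andP[t0 t1]; have [tm|tm] := ltP t (m%:R * eta).
    have [|v' v't Hv'] := H t; first by rewrite t0.
    by exists v' => // s /Hv' h; rewrite ge_min h.
  exists v; last by move=> s /H' h; rewrite ge_min h orbT.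
  by move: vI t1; rewrite -natr1 mulrDl mul1r ler_norml; lra.
have [r r0 H] := step (Num.truncn (1 / eta)).+1; exists r => // t /andP[t0 t1].
apply: H; rewrite t0 /=; apply: le_lt_trans t1 _.
by rewrite -ltr_pdivrMr// truncnS_gt.
Qed.

(** * From grids to the configuration set *)

(** Replacing points by the corners of their cells changes each normalized
    coordinate difference, a number in [-1, 1], by at most 2^-n. *)
Lemma incell_sqd (R : realType) (M : R) d n (a b : grid d (2 ^ n))
    (x y : 'rV[R]_d) :
  0 <= M -> incell M a x -> incell M b y ->
  `|gdist2 R a b / (2 ^ n)%:R ^+ 2 - sqd x y / (2 * M + 1) ^+ 2| <= 2 * d%:R /
    (2 ^ n)%:R.
Proof.
move=> M0 ax bY; set N : R := (2 ^ n)%:R.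
have N0 : 0 < N by rewrite ltr0n expn_gt0.
have L0 : 0 < 2 * M + 1 by lra.
rewrite /gdist2 /sqd !mulr_suml -sumrB.
apply: le_trans (ler_norm_sum _ _ _) _.
have -> : 2 * d%:R / N = \sum_(i < d) (2 / N) by rewrite sumr_const card_ord
  -mulr_natr; ring.
apply: ler_sum => i _.
have := ax i; have := bY i; rewrite -/N.
set X := (x ord0 i + M) / (2 * M + 1); set Y := (y ord0 i + M) / (2 * M + 1).
move=> /andP[h1 h2] /andP[h3 h4].
have -> : ((a i)%:R - (b i)%:R) ^+ 2 / N ^+ 2 -
    (x ord0 i - y ord0 i) ^+ 2 / (2 * M + 1) ^+ 2 =
  (((a i)%:R - (b i)%:R) - (X - Y) * N) * (((a i)%:R - (b i)%:R) + (X - Y) * N)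
    / N ^+ 2.
  rewrite /X /Y; field; rewrite !gt_eqF//.
have aN : (a i)%:R + 1 <= N by rewrite natr1 ler_nat.
have bN : (b i)%:R + 1 <= N by rewrite natr1 ler_nat.
have a0 : 0 <= (a i)%:R :> R by [].
have b0 : 0 <= (b i)%:R :> R by [].
rewrite normrM [X in _ * X <= _]gtr0_norm ?invr_gt0 ?exprn_gt0// ler_pdivrMr
  ?exprn_gt0//.
have -> : 2 / N * N ^+ 2 = 1 * (2 * N) by field; rewrite gt_eqF.
by rewrite normrM; apply: ler_pM => //; rewrite ler_norml; lra.
Qed.

Lemma gdist2_le (R : realType) d n (a b : grid d (2 ^ n)) :
  0 <= gdist2 R a b / (2 ^ n)%:R ^+ 2 <= d%:R.
Proof.
have N0 : 0 < (2 ^ n)%:R :> R by rewrite ltr0n expn_gt0.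
rewrite divr_ge0 ?sqr_ge0 ?sumr_ge0//=; last by move=> i _; apply: sqr_ge0.
rewrite ler_pdivrMr ?exprn_gt0// mulr_natl.
have -> : (2 ^ n)%:R ^+ 2 *+ d = \sum_(i < d) (2 ^ n)%:R ^+ 2 :> R.
  by rewrite sumr_const card_ord.
apply: ler_sum => i _; rewrite -[leLHS]real_normK ?num_real// ler_sqr ?nnegrE//.
have aN : (a i)%:R <= (2 ^ n)%:R :> R by rewrite ler_nat ltnW.
have bN : (b i)%:R <= (2 ^ n)%:R :> R by rewrite ler_nat ltnW.
have a0 : 0 <= (a i)%:R :> R by [].
have b0 : 0 <= (b i)%:R :> R by [].
by rewrite ler_norml; lra.
Qed.

Lemma sqd_le (R : realType) (M : R) d (x y : 'rV[R]_d) : 0 <= M ->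
  (forall i, `|x ord0 i| <= M) -> (forall i, `|y ord0 i| <= M) ->
  0 <= sqd x y / (2 * M + 1) ^+ 2 <= d%:R.
Proof.
move=> M0 xM yM; rewrite divr_ge0 ?sqr_ge0 ?sqd_ge0//= ler_pdivrMr
  ?exprn_gt0//; last by lra.
rewrite [leRHS]mulr_natl.
have -> : (2 * M + 1) ^+ 2 *+ d = \sum_(i < d) (2 * M + 1) ^+ 2.
  by rewrite sumr_const card_ord.
apply: ler_sum => i _; rewrite -[leLHS]real_normK ?num_real// ler_sqr
  ?nnegrE//; last by lra.
by have := xM i; have := yM i; rewrite !ler_norml; lra.
Qed.

Definition sqd_sum (R : realType) d (ys : seq 'rV[R]_d) (x : 'rV[R]_d) : R :=
  \sum_(y <- ys) sqd x y.

Lemma diag_config_mem (R : realType) d k (E : set 'rV[R]_d) x ys :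
  size ys = k.-1 -> uniq ys -> E x -> (forall y, y \in ys -> E y) ->
  diag_config_set k E (Num.sqrt (sqd_sum ys x)).
Proof.
move=> sz un Ex Eys; exists x, (fun i : 'I_k.-1 => nth 0 ys i); split=> //.
- by move=> i; apply: Eys; rewrite mem_nth// sz.
- by move=> i j ij; rewrite nth_uniq ?sz.
- rewrite enorm_concat /sqd_sum (big_nth 0) sz big_mkord //.
Qed.

Definition config_value (R : realType) d (kap : R) (qs : seq 'rV[R]_d)
    (p : 'rV[R]_d * 'rV[R]_d * 'rV[R]_d) : R :=
  kap * (sqd p.1.1 p.1.2 + (sqd p.1.1 p.2 + sqd_sum qs p.1.1)).

Lemma continuous_config_value (R : realType) d (kap : R) (qs : seq 'rV[R]_d) :
  continuous (config_value kap qs).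
Proof.
have c11 : continuous (fun p : 'rV[R]_d * 'rV[R]_d * 'rV[R]_d => p.1.1).
  by move=> q; apply: (continuous_comp (f := fst) (g := fst)); apply: cvg_fst.
have c12 : continuous (fun p : 'rV[R]_d * 'rV[R]_d * 'rV[R]_d => p.1.2).
  move=> q; apply: (continuous_comp (f := fst) (g := snd)).
    exact: cvg_fst.
  exact: cvg_snd.
have c22 : continuous (fun p : 'rV[R]_d * 'rV[R]_d * 'rV[R]_d => p.2).
  by move=> q; apply: cvg_snd.
have s12 := continuous_sqd c11 c12.
have s22 := continuous_sqd c11 c22.
have sq : continuous (fun p : 'rV[R]_d * 'rV[R]_d * 'rV[R]_d =>
    sqd_sum qs p.1.1).
  apply: continuous_sum => q; apply: (continuous_sqd c11 (g := fun=> q)) => r.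
  exact: cvg_cst.
move=> p.
have -> : config_value kap qs = cst kap \* ((fun p => sqd p.1.1 p.1.2) \+
    ((fun p => sqd p.1.1 p.2) \+ (fun p => sqd_sum qs p.1.1))) by [].
apply: continuousM; first exact: cvg_cst.
by apply: continuousD; [exact: s12|apply: continuousD; [exact: s22|exact: sq]].
Qed.

Lemma closed_config_values (R : realType) d (kap : R) (qs : seq 'rV[R]_d)
    (E1 E2 : set 'rV[R]_d) :
  compact E1 -> compact E2 ->
  closed (config_value kap qs @` ((E1 `*` E1) `*` E2)).
Proof.
move=> c1 c2; apply: compact_closed; first exact: norm_hausdorff.
apply: continuous_compact; last exact: (compact_setX (compact_setX c1 c1) c2).
exact/continuous_subspaceT/continuous_config_value.
Qed.

Lemma phase_range (R : realType) (M lam : R) d n (qs : seq 'rV[R]_d)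
    (x : 'rV[R]_d) (gam : grid d (2 ^ n) -> R) P :
  0 <= M -> 0 <= lam -> lam * (4 * (d%:R + 1) * ((size qs)%:R + 2)) = 1 ->
  (forall i, `|x ord0 i| <= M) ->
  (forall q, q \in qs -> forall i, `|q ord0 i| <= M) ->
  gam P.1.1 = lam / (2 * M + 1) ^+ 2 * sqd_sum qs x ->
  0 <= phase lam gam P <= 1 / 2.
Proof.
move=> M0 lam0 lamE xM qM gamE.
have /andP[g0 g1] : 0 <= gam P.1.1 <= lam * (d%:R * (size qs)%:R).
  rewrite gamE /sqd_sum -mulrA; apply/andP; split.
    rewrite mulr_ge0 ?mulr_ge0 ?invr_ge0 ?sqr_ge0 ?sumr_ge0// => y _.
    exact: sqd_ge0.
  rewrite ler_wpM2l// mulrC mulr_suml mulr_natr.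
  have -> : d%:R *+ size qs = \sum_(y <- qs) d%:R :> R.
    by rewrite big_const_seq iter_addr_0 count_predT.
  rewrite big_seq [leRHS]big_seq; apply: ler_sum => y yqs.
  by have /andP[_] := sqd_le M0 xM (qM _ yqs).
have /andP[a0 a1] := gdist2_le R P.1.1 P.1.2.
have /andP[b0 b1] := gdist2_le R P.1.1 P.2.
have h : 0 <= lam * (d%:R * (size qs)%:R) by rewrite mulr_ge0 ?mulr_ge0.
have hd : 0 <= lam * d%:R by rewrite mulr_ge0.
have hq : 0 <= lam * (size qs)%:R by rewrite mulr_ge0.
have := ler_wpM2l lam0 a1; have := ler_wpM2l lam0 b1.
have := mulr_ge0 lam0 a0; have := mulr_ge0 lam0 b0.
rewrite /phase [lam * (_ + _)]mulrDr mulrDl -!mulrA.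
move: a0 a1 b0 b1 => _ _ _ _; move: (_ / _ ^+ 2) (_ / _ ^+ 2) => u v.
move: lamE; clear - lam0 g0 g1 h hd hq;
  move: (gam _) g0 g1 => g g0 g1 lamE h1 h2 h3 h4.
by apply/andP; split; lra.
Qed.

Lemma phase_approx (R : realType) (M lam : R) d n (qs : seq 'rV[R]_d)
    (gam : grid d (2 ^ n) -> R) (a b c : grid d (2 ^ n)) (x y z : 'rV[R]_d) :
  0 <= M -> 0 <= lam -> 4 * (lam * d%:R) <= 1 ->
  incell M a x -> incell M b y -> incell M c z ->
  gam a = lam / (2 * M + 1) ^+ 2 * sqd_sum qs x ->
  `|phase lam gam (a, b, c) -
    config_value (lam / (2 * M + 1) ^+ 2) qs (x, y, z)| <= 1 / (2 ^ n)%:R.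
Proof.
move=> M0 lam0 lamd ax bY cz gamE; rewrite /phase /config_value gamE /=.
have := incell_sqd M0 ax cz; have := incell_sqd M0 ax bY.
have N0 : 0 < (2 ^ n)%:R :> R by rewrite ltr0n expn_gt0.
move: (gdist2 R a b) (gdist2 R a c) (sqd x y) (sqd x z) (sqd_sum qs x).
move: (2 * M + 1) (2 ^ n)%:R N0 => L N N0 g1 g2 d1 d2 q h1 h2.
have -> : lam * (g1 + g2) / N ^+ 2 + lam / L ^+ 2 * q -
    lam / L ^+ 2 * (d1 + (d2 + q)) =
   lam * ((g1 / N ^+ 2 - d1 / L ^+ 2) + (g2 / N ^+ 2 - d2 / L ^+ 2)) by ring.
rewrite normrM ger0_norm//.
apply: (@le_trans _ _ (lam * (2 * d%:R / N + 2 * d%:R / N))).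
  by rewrite ler_wpM2l//; apply: le_trans (ler_normD _ _) _; apply: lerD.
have -> : lam * (2 * d%:R / N + 2 * d%:R / N) = (4 * (lam * d%:R)) / N by ring.
by rewrite ler_pM2r ?invr_gt0.
Qed.

(** The set S of rescaled values is compact. If it had empty interior, it would
    avoid, with a uniform gap, points in every interval of length eta; but at a
    scale finer than the gap the discrete statement produces attained values
    near all points of such an interval. *)
Lemma frostman_config_interval (R : realType) (M s : R) d
    (E1 E2 : set 'rV[R]_d) (qs : seq 'rV[R]_d) :
  0 <= M -> d%:R + 1 < 2 * s ->
  compact E1 -> compact E2 -> ~ light s E1 -> ~ light s E2 ->
  (forall x, E1 x -> forall i, `|x ord0 i| <= M) ->
  (forall x, E2 x -> forall i, `|x ord0 i| <= M) ->
  (forall x, x \in qs -> forall i, `|x ord0 i| <= M) ->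
  exists u v, [/\ 0 <= u, u < v & forall t, u < t < v ->
    exists x y1 y2, [/\ E1 x, E1 y1, E2 y2 & t = sqd_sum [:: y1, y2 & qs] x]].
Proof.
move=> M0 sd c1 c2 nl1 nl2 M1 M2 Mq.
have s0 : 0 < s by have := ler0n R d; lra.
pose rho : R := 2 `^ (- s).
have rho0 : 0 <= rho by apply: powR_ge0.
have rho1 : 2 ^+ d.+1 * rho ^+ 2 < 1.
  have -> : rho ^+ 2 = 2 `^ (- (2 * s)).
    by rewrite -powR_mulrn ?powR_ge0// -powRrM; congr (_ `^ _); ring.
  rewrite powRN -powR_mulrn// ltr_pdivrMr ?powR_gt0// mul1r.
  rewrite /powR pnatr_eq0 /= ltr_expR ltr_pM2r ?ln_gt0 ?ltr1n//.
  by rewrite -natr1.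
have [m1 m10 F1] := frostman_set M0 s0 M1 nl1.
have [m2 m20 F2] := frostman_set M0 s0 M2 nl2.
pose L := 2 * M + 1; have L0 : 0 < L by rewrite /L; lra.
(* This size of lam keeps all phases in an interval of length 1/2, away from
   the period of the exponential. *)
pose lam : R := (4 * (d%:R + 1) * ((size qs)%:R + 2))^-1.
have den0 : 0 < 4 * (d%:R + 1) * ((size qs)%:R + 2) :> R.
  by rewrite !mulr_gt0// ltr_wpDl.
have lam0 : 0 < lam by rewrite invr_gt0.
have lamE : lam * (4 * (d%:R + 1) * ((size qs)%:R + 2)) = 1.
  by rewrite mulVf// gt_eqF.
have [lamd lamP] : 4 * (lam * d%:R) <= 1 /\ 0 < lam <= 1 / 4.
  have h1 : 0 <= lam * d%:R by rewrite mulr_ge0// ltW.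
  have h2 : 0 <= lam * (size qs)%:R by rewrite mulr_ge0// ltW.
  have h3 : 0 <= lam * d%:R * (size qs)%:R by rewrite mulr_ge0.
  rewrite lam0 /=; move: lamE lam0; clear - h1 h2 h3; move: lam h1 h2 h3.
  by move=> l h1 h2 h3 E l0; split; lra.
pose kap := lam / L ^+ 2.
have kap0 : 0 < kap by rewrite divr_gt0// exprn_gt0.
have cm : 0 < Num.min m1 m2 by rewrite lt_min m10.
have [eta eta0 DI] := discrete_interval (d := d) rho0 rho1 lamP cm.
pose S := config_value kap qs @` ((E1 `*` E1) `*` E2).
have SE t : 0 <= t -> S (kap * t) -> exists x y1 y2,
    [/\ E1 x, E1 y1, E2 y2 & t = sqd_sum [:: y1, y2 & qs] x].
  move=> t0 [[[x y1] y2] [[/= Ex Ey1] Ey2]] /(mulfI (lt0r_neq0 kap0)) Gt.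
  by exists x, y1, y2; split=> //; rewrite /sqd_sum !big_cons.
apply: contrapT => no_interval.
have dense u v : 0 <= u -> u < v -> exists2 t, u < t < v & ~ S t.
  move=> u0 uv; apply: contrapT => nex; apply: no_interval.
  exists (u / kap), (v / kap); split.
  - by rewrite divr_ge0// ltW.
  - by rewrite ltr_pM2r ?invr_gt0.
  - move=> t /andP[ut tv]; apply: SE.
      by apply: ltW; apply: le_lt_trans ut; rewrite divr_ge0// ltW.
    apply: contrapT => nS; apply: nex; exists (kap * t) => //.
    by rewrite mulrC -ltr_pdivrMr// ut -ltr_pdivlMr.
have [gap gap0 Hgap] := uniform_gap (closed_config_values (kap := kap) (qs :=
  qs) c1 c2) eta0 dense.
have gap2 : 0 < gap / 2 by rewrite divr_gt0.
have [n0 Hn] := DI (gap / 2) gap2.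
pose n := maxn n0 (Num.truncn (gap / 2)^-1).+1.
have {Hn} Hn := Hn n (leq_maxl _ _).
have [w1 [fw1 sup1 mass1]] := F1 n.
have [w2 [fw2 sup2 mass2]] := F2 n.
have NG : 1 / (2 ^ n)%:R < gap / 2.
  rewrite mul1r -[ltRHS]invrK ltf_pV2 ?posrE ?invr_gt0 ?ltr0n ?expn_gt0//.
  apply: (@lt_le_trans _ _ (Num.truncn (gap / 2)^-1).+1%:R).
    exact: truncnS_gt.
  rewrite ler_nat (leq_trans (leq_maxr n0 _))//.
  by apply: ltnW; apply: ltn_expl.
(* A cell of positive weight meets E1; evaluating the fixed part of the sum at
   a point of E1 in the cell makes that part free of discretization error. *)
pose rep a x := w1 a != 0 -> E1 x /\ incell M a x.
have [pt ptP] : {pt : grid d (2 ^ n) -> 'rV[R]_d & forall a, rep a (pt a)}.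
  apply: (@boolp.choice _ _ rep) => a; rewrite /rep.
  have [_|w1a] := eqVneq (w1 a) 0; first by exists 0.
  by have [x Ex ax] := sup1 a w1a; exists x.
pose gam a := kap * sqd_sum qs (pt a).
have posW (a b c : grid d (2 ^ n)) : 0 < w1 a * w1 b * w2 c ->
    [/\ w1 a != 0, w1 b != 0 & w2 c != 0].
  move=> h; split; apply/eqP => E; move: h;
    by rewrite E ?mul0r ?mulr0 ?mul0r ltxx.
have rng P : 0 < w1 P.1.1 * w1 P.1.2 * w2 P.2 -> 0 <= phase lam gam P <= 1 / 2.
  case: P => -[a b] c /posW [/= wa _ _]; have [Ea _] := ptP a wa.
  exact: (phase_range (x := pt a) M0 (ltW lam0) lamE (M1 _ Ea) Mq).
have approx P : 0 < w1 P.1.1 * w1 P.1.2 * w2 P.2 ->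
    exists2 t, S t & `|phase lam gam P - t| <= 1 / (2 ^ n)%:R.
  case: P => -[a b] c /posW [/= wa wb wc].
  have [Ea ca] := ptP a wa; have [Eb cb] := ptP b wb.
  have [y Ey cy] := sup2 c wc.
  exists (config_value kap qs (pt a, pt b, y)); first by exists (pt a, pt b, y).
  exact: phase_approx (ltW lam0) lamd ca cb cy _.
have cm1 : Num.min m1 m2 <= \sum_a w1 a by rewrite ge_min mass1.
have cm2 : Num.min m1 m2 <= \sum_a w2 a by rewrite ge_min mass2 orbT.
have [P WP HP] := Hn w1 w1 w2 gam fw1 fw1 fw2 cm1 cm1 cm2 rng.
have /andP[ph0 ph1] := rng P WP.
have ph2 : phase lam gam P <= 1 by apply: le_trans ph1 _; clear; lra.
have [|v vP Hv] := Hgap (phase lam gam P); first by rewrite ph0.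
have [P' WP' HP'] := HP v vP.
have [t St tP'] := approx P' WP'.
have := Hv t St; rewrite leNgt => /negP; apply.
have -> : t - v = (phase lam gam P' - v) - (phase lam gam P' - t) by ring.
apply: le_lt_trans (ler_normB _ _) _; rewrite [ltRHS]splitr.
by apply: ltrD => //; apply: le_lt_trans NG.
Qed.

Theorem theorem3p2 (R : realType) (d k : nat) (E : set 'rV[R]_d)
  (hd : (2 <= d)%N) (hk : (3 <= k)%N) (hE : compact E)
  (hdim : ((dim_threshold R d k)%:E < hausdorff_dim E)%E) :
  interior (diag_config_set k E) !=set0.
Proof.
have [s ths sdim] := lte_fin_between hdim.
have thr := dim_threshold_ge R hd hk.
have sd : d%:R + 1 < 2 * s by lra.
have s0 : 0 < s by have := ler0n R d; lra.
have nlE := not_light s0 sdim.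
have [ps [szps unps heavy]] := heavy_points k.-1 s0 hE nlE.
case: ps szps unps heavy => [|p1 [|p2 qs]];
  [by case: k hk {hdim ths thr} => [|[|[|]]]..|].
move=> szps /= /and3P[p1n p2n unqs] heavy.
have [r1 r10 H1] := separating_radius p1n.
have [r2 r20 H2] := separating_radius p2n.
(* Two points of the boxes around p1 and p2 cannot coincide, as p2 is at
   distance more than r1 from p1. *)
pose r := Num.min (r1 / 2) r2.
have r0 : 0 < r by rewrite lt_min divr_gt0.
have rr1 : r <= r1 / 2 by rewrite ge_min lexx.
have rr2 : r <= r2 by rewrite ge_min lexx orbT.
have [Ep1 hp1] := heavy p1 ltac:(by rewrite inE eqxx).
have [Ep2 hp2] := heavy p2 ltac:(by rewrite !inE eqxx orbT).
have Eqs q : q \in qs -> E q by move=> qqs;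
  have [] := heavy q ltac:(by rewrite !inE qqs !orbT).
have [M M0 EM] := compact_coord_bound hE.
have [u [v [u0 uv Huv]]] := frostman_config_interval (qs := qs) M0 sd
  (compact_closedI hE (inbox_closed (p := p1) (r := r)))
  (compact_closedI hE (inbox_closed (p := p2) (r := r))) (hp1 r r0) (hp2 r r0)
  (fun x Ex => EM x Ex.1) (fun x Ex => EM x Ex.1) (fun x qx => EM x (Eqs x qx)).
(* The square roots of the values controlled so far are configuration values:
   the separation of the boxes makes the points pairwise distinct. *)
have sub : [set t : R | 0 < t /\ u < t ^+ 2 < v] `<=` diag_config_set k E.
  move=> t [t0 /Huv [x [y1 [y2 [[Ex _] [Ey1 by1] [Ey2 by2] tE]]]]].
  have -> : t = Num.sqrt (sqd_sum [:: y1, y2 & qs] x).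
    by rewrite -tE sqrtr_sqr gtr0_norm.
  apply: diag_config_mem => //.
    rewrite /= !inE negb_or unqs andbT; apply/andP; split; last first.
      by apply/negP => y2q; apply: (H2 y2 y2q) => i; apply: le_trans (by2 i) _.
    apply/andP; split; last first.
      apply/negP => y1q; apply: (H1 y1); first by rewrite inE y1q orbT.
      by move=> i; apply: le_trans (by1 i) _; lra.
    apply/eqP => y12; apply: (H1 p2); first by rewrite inE eqxx.
    move=> i; have := by1 i; have := by2 i; rewrite y12 !ler_norml; lra.
  by move=> y; rewrite !inE => /or3P[/eqP->|/eqP->|/Eqs].
exists (Num.sqrt ((u + v) / 2)); apply: (filterS sub).
have cq : continuous (fun t : R => t ^+ 2) by move=> t; exact: exprn_continuous.
have m0 : 0 < (u + v) / 2 by lra.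
apply: filterI; first by apply: (@lt_nbhsr R); rewrite sqrtr_gt0.
apply: (cq (Num.sqrt ((u + v) / 2)) [set z | u < z < v]).
rewrite sqr_sqrtr ?(ltW m0)//.
have : nbhs ((u + v) / 2) `]u, v[%classic.
  by apply: near_in_itvoo; rewrite in_itv /=; lra.
by apply: filterS => z /=; rewrite in_itv.
Qed.
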